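(* Let $\Psi=(X,A,q,g)$ be a standard MDP where $X$ is a compact subset of a simplex $\Delta(K)$ ($K$ finite), $A$ is a nonempty set, $q:X\times A\to\Delta_f(X)$ and $g:X\times A\to[0,1]$. Assume that for all $x,y\in X$, $a\in A$, $f\in D_1$ and $\alpha,\beta\ge0$: - $|\alpha f(q(x,a))-\beta f(q(y,a))|\le\|\alpha x-\beta y\|_1$, and - $|\alpha g(x,a)-\beta g(y,a)|\le\|\alpha x-\beta y\|_1$. Then $\Psi$ has a general uniform value $v^*$, given for each $x\in X$ by $$v^*(x)=\inf\Big\{w(\delta_x):\ w:\Delta(X)\to[0,1]\text{ affine and weak-* continuous, such that (1) and (2) hold}\Big\},$$ where the two conditions on $w$ are: - (1) $w(\delta_{x'})\ge\sup_{a\in A}w(q(x',a))$ for all $x'\in X$; - (2) $w(u)\ge y$ for all $(u,y)\in RR$.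
   Context: **Test functions.** $D_1=\{f\in\mathcal C(\Delta(K)):\ \forall x,y\in\Delta(K),\ \forall a,b\ge0,\ af(x)-bf(y)\le\|ax-by\|_1\}$, where $\|p\|_1=\sum_k|p^k|$. Such $f$ is extended linearly to finitely supported probabilities: $f(u)=\sum_xu(x)f(x)$. **Play and values.** At each stage the player observes the current state $x$ and chooses an action $a$, gets $g(x,a)$, and the next state is drawn from $q(x,a)$. - A (behavior) strategy is a sequence $\sigma_t:(X\times A)^{t-1}\to\Delta_f(A)$. - For an evaluation $\theta\in\Delta(\mathbb N^* )$, $\gamma_\theta(x_1,\sigma)=\mathbb E_{x_1,\sigma}\big(\sum_t\theta_tg(x_t,a_t)\big)$ and $v_\theta(x_1)=\sup_\sigma\gamma_\theta(x_1,\sigma)$. - Impatience is $I(\theta)=\sum_t|\theta_{t+1}-\theta_t|$. **General values.** A general limit value $v^*$ exists if $\sup_x|v_\theta(x)-v^*(x)|\to0$ as $I(\theta)\to0$. A general uniform value exists if moreover, for every $\varepsilon>0$, there exist $\alpha>0$ and strategies $\sigma(x)$ such that $I(\theta)\le\alpha$ implies $\gamma_\theta(x,\sigma(x))\ge v^*(x)-\varepsilon$ for all $x$. **Invariant couples.** For $(u,y)\in\Delta_f(X)\times[0,1]$ define $$\hat F(u,y)=\Big\{\Big(\sum_xu(x)q(x,\sigma(x)),\ \sum_xu(x)g(x,\sigma(x))\Big):\ \sigma:X\to\Delta_f(A)\Big\},$$ with $q(x,\cdot)$ and $g(x,\cdot)$ extended linearly to $\Delta_f(A)$. Then $$RR=\{(u,y)\in\Delta(X)\times[0,1]:\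 ((u,y),(u,y))\in\mathrm{cl}(\mathrm{Graph}\,\hat F)\},$$ where the closure is taken in $(\Delta(X)\times[0,1])^2$ with the weak-* topology on $\Delta(X)$. *)

(* Defs.v *)
From Stdlib Require Import Reals Lra List.
Import ListNotations.
Open Scope R_scope.

(** Points of R^K, represented as functions nat -> R (coordinates k < K). *)
Definition pt := nat -> R.

Fixpoint sumK (n : nat) (f : nat -> R) : R :=
  match n with O => 0 | S m => sumK m f + f m end.

Definition norm1 (K : nat) (p : pt) : R := sumK K (fun k => Rabs (p k)).

Definition lin (a : R) (x : pt) (b : R) (y : pt) : pt := fun k => a * x k - b * y k.

Definition simplex (K : nat) (p : pt) : Prop :=
  (forall k, (k < K)%nat -> 0 <= p k) /\ (forall k, (K <= k)%nat -> p k = 0)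
  /\ sumK K p = 1.

(** compactness of X (in R^K, equivalently sequential compactness) *)
Definition seq_compact (K : nat) (X : pt -> Prop) : Prop :=
  forall u : nat -> pt, (forall n, X (u n)) ->
    exists phi : nat -> nat, (forall n, (phi n < phi (S n))%nat) /\
      exists l, X l /\ forall eps, eps > 0 -> exists N, forall n, (n >= N)%nat ->
        norm1 K (fun k => u (phi n) k - l k) < eps.

Definition cont_on (K : nat) (S : pt -> Prop) (f : pt -> R) : Prop :=
  forall x, S x -> forall eps, eps > 0 -> exists d, d > 0 /\
    forall y, S y -> norm1 K (fun k => y k - x k) < d -> Rabs (f y - f x) < eps.

Definition D1 (K : nat) (f : pt -> R) : Prop :=
  cont_on K (simplex K) f /\
  forall x y a b, simplex K x -> simplex K y -> 0 <= a -> 0 <= b ->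
    a * f x - b * f y <= norm1 K (lin a x b y).

(** Finitely supported probabilities, as lists of (point, weight). *)
Definition total {T : Type} (u : list (T * R)) : R :=
  fold_right (fun p s => snd p + s) 0 u.

Definition is_fdist {T : Type} (P : T -> Prop) (u : list (T * R)) : Prop :=
  Forall (fun p => P (fst p) /\ 0 <= snd p) u /\ total u = 1.

Definition fexp {T : Type} (u : list (T * R)) (h : T -> R) : R :=
  fold_right (fun p s => snd p * h (fst p) + s) 0 u.

Definition qmix {A : Type} (q : pt -> A -> list (pt * R)) (x : pt)
  (s : list (A * R)) : list (pt * R) :=
  flat_map (fun ap => map (fun yp => (fst yp, snd ap * snd yp)) (q x (fst ap))) s.

Definition hist (A : Type) := list (pt * A).
(** behavior strategy: past history (x_1,a_1,...,x_{t-1},a_{t-1}) and current state x_t *)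
Definition strategy (A : Type) := hist A -> pt -> list (A * R).

Definition valid_strategy {A : Type} (sg : strategy A) : Prop :=
  forall h x, is_fdist (fun _ : A => True) (sg h x).

(** distribution of (past history, current state) at stage n+1 *)
Fixpoint stage_dist {A : Type} (q : pt -> A -> list (pt * R)) (sg : strategy A)
  (x1 : pt) (n : nat) : list ((hist A * pt) * R) :=
  match n with
  | O => [(([], x1), 1)]
  | S m =>
      flat_map (fun e =>
        let h := fst (fst e) in let x := snd (fst e) in let p := snd e in
        flat_map (fun ap =>
          map (fun yp => ((h ++ [(x, fst ap)], fst yp), p * snd ap * snd yp))
              (q x (fst ap)))
          (sg h x))
        (stage_dist q sg x1 m)
  end.

Definition stage_payoff {A : Type} (q : pt -> A -> list (pt * R)) (g : pt -> A -> R)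
  (sg : strategy A) (x1 : pt) (n : nat) : R :=
  fexp (stage_dist q sg x1 n) (fun hx => fexp (sg (fst hx) (snd hx)) (g (snd hx))).

(** evaluation theta in Delta(positive integers): theta n is the weight of stage n+1 *)
Definition is_eval (theta : nat -> R) : Prop :=
  (forall n, 0 <= theta n) /\ infinite_sum theta 1.

Definition impatience_is (theta : nat -> R) (r : R) : Prop :=
  infinite_sum (fun n => Rabs (theta (S n) - theta n)) r.

Definition gamma_is {A : Type} (q : pt -> A -> list (pt * R)) (g : pt -> A -> R)
  (theta : nat -> R) (x1 : pt) (sg : strategy A) (r : R) : Prop :=
  infinite_sum (fun n => theta n * stage_payoff q g sg x1 n) r.

Definition value_is {A : Type} (q : pt -> A -> list (pt * R)) (g : pt -> A -> R)
  (theta : nat -> R) (x : pt) (v : R) : Prop :=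
  is_lub (fun r => exists sg : strategy A, valid_strategy sg /\ gamma_is q g theta x sg r) v.

Definition general_limit_value {A : Type} (X : pt -> Prop)
  (q : pt -> A -> list (pt * R)) (g : pt -> A -> R) (vs : pt -> R) : Prop :=
  forall eps, eps > 0 -> exists al, al > 0 /\
    forall theta I, is_eval theta -> impatience_is theta I -> I <= al ->
      forall x v, X x -> value_is q g theta x v -> Rabs (v - vs x) <= eps.

Definition general_uniform_value {A : Type} (X : pt -> Prop)
  (q : pt -> A -> list (pt * R)) (g : pt -> A -> R) (vs : pt -> R) : Prop :=
  general_limit_value X q g vs /\
  forall eps, eps > 0 -> exists al, al > 0 /\
    exists sgs : pt -> strategy A, (forall x, X x -> valid_strategy (sgs x)) /\
      forall theta I, is_eval theta -> impatience_is theta I -> I <= al ->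
        forall x r, X x -> gamma_is q g theta x (sgs x) r -> r >= vs x - eps.

(** ** Delta(X): Borel probabilities on the compact X, represented (Riesz)
    as normalized positive linear functionals on C(X). *)
Definition meas := (pt -> R) -> R.

Definition is_prob (K : nat) (X : pt -> Prop) (u : meas) : Prop :=
  (forall h1 h2, cont_on K X h1 -> cont_on K X h2 ->
      u (fun x => h1 x + h2 x) = u h1 + u h2) /\
  (forall c h, cont_on K X h -> u (fun x => c * h x) = c * u h) /\
  (forall h, cont_on K X h -> (forall x, X x -> 0 <= h x) -> 0 <= u h) /\
  u (fun _ => 1) = 1.

Definition dirac (x : pt) : meas := fun h => h x.
Definition emb (u : list (pt * R)) : meas := fun h => fexp u h.

Definition near (hs : list (pt -> R)) (d : R) (u u' : meas) : Prop :=
  Forall (fun h => Rabs (u' h - u h) < d) hs.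

Definition wstar_cont (K : nat) (X : pt -> Prop) (w : meas -> R) : Prop :=
  forall u, is_prob K X u -> forall eps, eps > 0 ->
    exists hs d, Forall (cont_on K X) hs /\ d > 0 /\
      forall u', is_prob K X u' -> near hs d u u' -> Rabs (w u' - w u) < eps.

Definition affine_on (K : nat) (X : pt -> Prop) (w : meas -> R) : Prop :=
  forall u u' l, is_prob K X u -> is_prob K X u' -> 0 <= l <= 1 ->
    w (fun h => l * u h + (1 - l) * u' h) = l * w u + (1 - l) * w u'.

(** F-hat: image of (u, y) under the stationary selection s : X -> Delta_f(A) *)
Definition fnext {A : Type} (q : pt -> A -> list (pt * R)) (u : list (pt * R))
  (s : pt -> list (A * R)) : list (pt * R) :=
  flat_map (fun xp => map (fun yp => (fst yp, snd xp * snd yp)) (qmix q (fst xp) (s (fst xp)))) u.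

Definition fpay {A : Type} (g : pt -> A -> R) (u : list (pt * R))
  (s : pt -> list (A * R)) : R :=
  fexp u (fun x => fexp (s x) (g x)).

(** (u,y) in RR: ((u,y),(u,y)) is in the weak-* closure of Graph F-hat *)
Definition RR {A : Type} (K : nat) (X : pt -> Prop) (q : pt -> A -> list (pt * R))
  (g : pt -> A -> R) (u : meas) (y : R) : Prop :=
  is_prob K X u /\ 0 <= y <= 1 /\
  forall hs d, Forall (cont_on K X) hs -> d > 0 ->
    exists (u0 : list (pt * R)) (y0 : R) (s : pt -> list (A * R)),
      is_fdist X u0 /\ 0 <= y0 <= 1 /\
      (forall x, X x -> is_fdist (fun _ : A => True) (s x)) /\
      near hs d u (emb u0) /\ Rabs (y0 - y) < d /\
      near hs d u (emb (fnext q u0 s)) /\ Rabs (fpay g u0 s - y) < d.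

Definition admissible {A : Type} (K : nat) (X : pt -> Prop) (q : pt -> A -> list (pt * R))
  (g : pt -> A -> R) (w : meas -> R) : Prop :=
  (forall u, is_prob K X u -> 0 <= w u <= 1) /\
  affine_on K X w /\ wstar_cont K X w /\
  (forall x' a, X x' -> w (dirac x') >= w (emb (q x' a))) /\
  (forall u y, RR K X q g u y -> w u >= y).

Definition vstar_set {A : Type} (K : nat) (X : pt -> Prop) (q : pt -> A -> list (pt * R))
  (g : pt -> A -> R) (x : pt) : R -> Prop :=
  fun r => exists w, admissible K X q g w /\ r = w (dirac x).

Definition is_glb (E : R -> Prop) (v : R) : Prop :=
  (forall r, E r -> v <= r) /\ (forall b, (forall r, E r -> b <= r) -> b <= v).

(* Main.v *)
(** Let [V theta] be the value function of the evaluation [theta]; it is 1-Lipschitz in the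
    homogeneous sense [a f x - b f y <= |a x - b y|], a class preserved by the Bellman operators
    because such functions extend to [D1].

    Lower bound: the least excessive majorant of [V theta] is an admissible [w]: it exceeds [y] on
    [RR] since a nearly invariant selection may be replayed for as long as one likes.  By total
    boundedness this majorant is almost reached within a number of steps independent of [theta],
    and each step costs at most the impatience of [theta]; so [V theta >= vs - eps].

    Upper bound: as the impatience vanishes, occupation measures of good plays accumulate at
    invariant couples, so [V theta x] is asymptotically at most [w (dirac x)].

    Uniformity: the patient evaluations form a convex set and [V] is convex in [theta], so a minimax
    argument at each stage, with summable errors, produces one sequence of selections that is
    good against all of them at once. *)

Require Import Defs.
From Stdlib Require Import Reals Lra Lia List Classical ClassicalEpsilon FunctionalExtensionality.
From mathcomp Require filter.
Import ListNotations.
Open Scope R_scope.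

(** * Finite sums, finitely supported measures and suprema *)

(** The hypothesis on [q] can be tested only on functions of [D1], which live on the whole simplex,
    whereas value functions live on [X]. Homogeneity serves both the extension and the bookkeeping
    of constants: a Bellman step of weight [t0] raises the Lipschitz constant by [t0], and the
    weights sum to at most 1. Shifted evaluations lose mass, so the work is done with
    sub-probabilities and partial sums; series return only at the end.

    Weak-* compactness is replaced by an ultrafilter, which gives limits of all integrals at once.
    Conversely, membership in [RR] controls only finitely many test functions at a time, which
    forces replays of a fixed finite length.

    Two exchanges of quantifiers remain. The infimum [vs] has no visible regularity, and the upper
    bound first comes with a threshold depending on the state; comparison with the Lipschitz
    functions [V theta] makes [vs] Lipschitz, and then the threshold uniform. Secondly, near-optimal
    play depends on [theta]; but at a given stage [theta] matters, up to a small error, only through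
    finitely many numbers, so a finite minimax suffices. *)

Lemma Rabs_bound x a : Rabs x <= a -> - a <= x <= a.
Proof.
  intros H. pose proof (Rle_abs x). pose proof (Rle_abs (- x)). rewrite Rabs_Ropp in *. lra.
Qed.

Lemma sumK_ext n f h : (forall k, (k < n)%nat -> f k = h k) -> sumK n f = sumK n h.
Proof.
  induction n as [|n IH]; simpl; intros H; [reflexivity|].
  rewrite IH, H; auto.
Qed.

Lemma sumK_le n f h : (forall k, (k < n)%nat -> f k <= h k) -> sumK n f <= sumK n h.
Proof.
  induction n as [|n IH]; simpl; intros H; [lra|].
  apply Rplus_le_compat; auto.
Qed.

Lemma sumK_lin n a f b h :
  sumK n (fun k => a * f k + b * h k) = a * sumK n f + b * sumK n h.
Proof. induction n as [|n IH]; simpl; [|rewrite IH]; ring. Qed.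

Lemma sumK_zero n : sumK n (fun _ => 0) = 0.
Proof. induction n as [|n IH]; simpl; lra. Qed.

Lemma sumK_nonneg n f : (forall k, (k < n)%nat -> 0 <= f k) -> 0 <= sumK n f.
Proof. intros H. rewrite <- (sumK_zero n). now apply sumK_le. Qed.

Lemma sumK_first n f : sumK (S n) f = f 0%nat + sumK n (fun k => f (S k)).
Proof.
  induction n as [|n IH]; [simpl; ring|].
  change (sumK (S (S n)) f) with (sumK (S n) f + f (S n)). rewrite IH. simpl. ring.
Qed.

Lemma sumK_mono f n m : (forall k, 0 <= f k) -> (n <= m)%nat -> sumK n f <= sumK m f.
Proof.
  intros H Hnm. induction Hnm as [|m _ IH]; simpl; [lra|]. specialize (H m). lra.
Qed.

Lemma sumK_add f n m : sumK (n + m) f = sumK n f + sumK m (fun k => f (n + k)%nat).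
Proof.
  induction m as [|m IH]; simpl; [rewrite Nat.add_0_r; ring|].
  rewrite Nat.add_succ_r. simpl. rewrite IH. ring.
Qed.

Lemma sum_f_R0_sumK f n : sum_f_R0 f n = sumK (S n) f.
Proof. induction n as [|n IH]; simpl in *; [ring|rewrite IH; ring]. Qed.

Lemma fexp_app {T} (u u' : list (T * R)) f : fexp (u ++ u') f = fexp u f + fexp u' f.
Proof. induction u as [|e u IH]; simpl; [|rewrite IH]; ring. Qed.

Section FiniteMeasures.
Context {T : Type}.
Implicit Types (u : list (T * R)) (f h : T -> R) (P : T -> Prop).

Lemma fexp_lin u a f b h :
  fexp u (fun x => a * f x + b * h x) = a * fexp u f + b * fexp u h.
Proof. induction u as [|e u IH]; simpl; [|rewrite IH]; ring. Qed.

Lemma fexp_const u c : fexp u (fun _ => c) = c * total u.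
Proof. induction u as [|e u IH]; simpl; [|rewrite IH]; ring. Qed.

Lemma total_fexp u : total u = fexp u (fun _ => 1).
Proof. rewrite fexp_const. ring. Qed.

Lemma fexp_le P u f h :
  Forall (fun p => P (fst p) /\ 0 <= snd p) u ->
  (forall x, P x -> f x <= h x) -> fexp u f <= fexp u h.
Proof.
  intros Hu Hfh. induction Hu as [|e u [He1 He2] _ IH]; simpl; [lra|].
  apply Rplus_le_compat; [apply Rmult_le_compat_l|]; auto.
Qed.

Lemma fexp_nonneg P u f :
  Forall (fun p => P (fst p) /\ 0 <= snd p) u ->
  (forall x, P x -> 0 <= f x) -> 0 <= fexp u f.
Proof.
  intros Hu Hf. replace 0 with (fexp u (fun _ => 0)).
  - now apply fexp_le with P.
  - rewrite fexp_const. ring.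
Qed.

Lemma total_nonneg P u : Forall (fun p => P (fst p) /\ 0 <= snd p) u -> 0 <= total u.
Proof. intros Hu. rewrite total_fexp. apply fexp_nonneg with P; auto. intros; lra. Qed.

Lemma fexp_total0 P u f :
  Forall (fun p => P (fst p) /\ 0 <= snd p) u -> total u = 0 -> fexp u f = 0.
Proof.
  intros Hu. induction Hu as [|[z r] u [Hz Hr] Hu IH]; simpl in *; [reflexivity|].
  intros E. pose proof (total_nonneg P u Hu).
  rewrite IH by lra. replace r with 0 by lra. ring.
Qed.

Lemma fexp_ext P u f h :
  Forall (fun p => P (fst p) /\ 0 <= snd p) u ->
  (forall x, P x -> f x = h x) -> fexp u f = fexp u h.
Proof.
  intros Hu Hfh. apply Rle_antisym; eapply fexp_le; eauto;
    intros x Hx; rewrite (Hfh x Hx); lra.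
Qed.

Lemma fexp_ge_const P u f c :
  is_fdist P u -> (forall x, P x -> c <= f x) -> c <= fexp u f.
Proof.
  intros [Hu Ht] Hf. replace c with (fexp u (fun _ => c)).
  - now apply fexp_le with P.
  - rewrite fexp_const, Ht. ring.
Qed.

Lemma fexp_le_const P u f c :
  is_fdist P u -> (forall x, P x -> f x <= c) -> fexp u f <= c.
Proof.
  intros [Hu Ht] Hf. replace c with (fexp u (fun _ => c)).
  - now apply fexp_le with P.
  - rewrite fexp_const, Ht. ring.
Qed.

Lemma fexp_le_plus P u f h c :
  is_fdist P u -> (forall x, P x -> f x <= h x + c) -> fexp u f <= fexp u h + c.
Proof.
  intros [Hu Ht] Hf. replace (fexp u h + c) with (fexp u (fun x => 1 * h x + c * 1)).
  - apply fexp_le with P; auto. intros x Hx. specialize (Hf x Hx). lra.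
  - rewrite fexp_lin, fexp_const, Ht. ring.
Qed.

Lemma fexp_map {T'} u (c : T -> T') p (h : T' -> R) :
  fexp (map (fun yp => (c (fst yp), p * snd yp)) u) h = p * fexp u (fun y => h (c y)).
Proof. induction u as [|e u IH]; simpl; [|rewrite IH]; ring. Qed.

Lemma fexp_scal u c f : fexp u (fun x => c * f x) = c * fexp u f.
Proof. induction u as [|e u IH]; simpl; [|rewrite IH]; ring. Qed.

Lemma fexp_flat_map {T'} (H : T -> R) u (h : T' -> R) (k : T * R -> list (T' * R)) :
  (forall e, fexp (k e) h = snd e * H (fst e)) -> fexp (flat_map k u) h = fexp u H.
Proof.
  intros Hk. induction u as [|e u IH]; simpl; [reflexivity|].
  rewrite fexp_app, IH, Hk. reflexivity.
Qed.

Lemma Forall_flat_map_weight {T'} P (P' : T' -> Prop) u (k : T * R -> list (T' * R)) :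
  Forall (fun p => P (fst p) /\ 0 <= snd p) u ->
  (forall e, P (fst e) -> 0 <= snd e -> Forall (fun p => P' (fst p) /\ 0 <= snd p) (k e)) ->
  Forall (fun p => P' (fst p) /\ 0 <= snd p) (flat_map k u).
Proof.
  intros Hu Hk. induction Hu as [|e u [He1 He2] _ IH]; simpl; [constructor|].
  apply Forall_app. split; auto.
Qed.

Lemma Forall_map_weight {T'} P (P' : T' -> Prop) u (c : T -> T') p :
  0 <= p -> Forall (fun p => P (fst p) /\ 0 <= snd p) u ->
  (forall x, P x -> P' (c x)) ->
  Forall (fun p => P' (fst p) /\ 0 <= snd p) (map (fun yp => (c (fst yp), p * snd yp)) u).
Proof.
  intros Hp Hu Hc. induction Hu as [|e u [He1 He2] _ IH]; simpl; constructor; auto.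
  simpl. split; [auto|now apply Rmult_le_pos].
Qed.

Definition mix (l : R) u u' : list (T * R) :=
  map (fun yp => (fst yp, l * snd yp)) u ++ map (fun yp => (fst yp, (1 - l) * snd yp)) u'.

Lemma fexp_mix l u u' f : fexp (mix l u u') f = l * fexp u f + (1 - l) * fexp u' f.
Proof.
  unfold mix. rewrite fexp_app, (fexp_map u (fun x => x)), (fexp_map u' (fun x => x)).
  reflexivity.
Qed.

Lemma fdist_mix P l u u' :
  0 <= l <= 1 -> is_fdist P u -> is_fdist P u' -> is_fdist P (mix l u u').
Proof.
  intros Hl [Hu Ht] [Hu' Ht']. split.
  - apply Forall_app. split.
    + apply (Forall_map_weight P P u (fun x => x)); auto; lra.
    + apply (Forall_map_weight P P u' (fun x => x)); auto; lra.
  - rewrite total_fexp, fexp_mix, <- !total_fexp, Ht, Ht'. ring.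
Qed.

Lemma fdist_dirac P x : P x -> is_fdist P [(x, 1)].
Proof. intros Hx. split; [repeat constructor; simpl; auto; lra|simpl; ring]. Qed.

End FiniteMeasures.

(* Junk value when [F] has no least upper bound. *)
Definition isup {I : Type} (F : I -> R) : R :=
  epsilon (inhabits 0) (is_lub (fun r => exists i, r = F i)).

Section Suprema.
Context {I : Type} (F : I -> R) (M : R) (HI : inhabited I) (HM : forall i, F i <= M).

Lemma isup_lub : is_lub (fun r => exists i, r = F i) (isup F).
Proof.
  unfold isup. apply epsilon_spec. destruct HI as [i].
  destruct (completeness (fun r => exists i, r = F i)) as [s Hs]; [| |now exists s].
  - exists M. intros r [j ->]. apply HM.
  - now exists (F i), i.
Qed.

Lemma isup_ub i : F i <= isup F.
Proof. apply isup_lub. now exists i. Qed.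

Lemma isup_le C : (forall i, F i <= C) -> isup F <= C.
Proof. intros H. apply isup_lub. intros r [i ->]. apply H. Qed.

Lemma isup_approx e : 0 < e -> exists i, isup F - e < F i.
Proof.
  intros He. apply NNPP. intros H.
  assert (isup F <= isup F - e); [|lra].
  apply isup_le. intros i. apply Rnot_lt_le. intros Hi. apply H. now exists i.
Qed.

End Suprema.

(** Monotone convergence for finite support: since [F n x] increases in [n], the finitely many atoms
    of [u] share one index at which all suprema are almost reached. *)
Lemma fexp_isup {T} (P : T -> Prop) (F : nat -> T -> R) M u C :
  is_fdist P u ->
  (forall n x, P x -> F n x <= F (S n) x) -> (forall n x, P x -> F n x <= M) ->
  (forall n, fexp u (F n) <= C) -> fexp u (fun x => isup (fun n => F n x)) <= C.
Proof.
  intros Hu Hmon HM HC. apply Rnot_lt_le. intros Hlt.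
  set (e := fexp u (fun x => isup (fun n => F n x)) - C).
  assert (Hmon' : forall n m x, P x -> (n <= m)%nat -> F n x <= F m x).
  { intros n m x Hx Hnm. induction Hnm as [|m _ IH]; [lra|]. specialize (Hmon m x Hx). lra. }
  assert (Hn : exists n, forall x p, In (x, p) u -> isup (fun n => F n x) <= F n x + e / 2).
  { assert (He : 0 < e) by (unfold e; lra). destruct Hu as [Hu _].
    clearbody e. clear Hlt HC. induction Hu as [|[z r] u [Hz Hr] Hu [n Hn]].
    - exists 0%nat. intros ? ? [].
    - simpl in Hz.
      destruct (isup_approx (fun n => F n z) M (inhabits 0%nat) (fun n => HM n z Hz) (e / 2))
        as [m Hm]; [lra|].
      exists (max n m). intros x' p' [E|Hin].
      + injection E as <- <-. pose proof (Hmon' m (max n m) z Hz ltac:(lia)). lra.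
      + specialize (Hn x' p' Hin).
        assert (Px' : P x') by (rewrite Forall_forall in Hu; apply (Hu _ Hin)).
        pose proof (Hmon' n (max n m) x' Px' ltac:(lia)). lra. }
  destruct Hn as [n Hn].
  assert (H : fexp u (fun x => isup (fun n => F n x)) <= fexp u (F n) + e / 2).
  { apply fexp_le_plus with (fun x => exists p, In (x, p) u).
    - destruct Hu as [Hu Ht]. split; [|exact Ht]. rewrite Forall_forall in *.
      intros [x p] Hin. split; [now exists p|apply (Hu _ Hin)].
    - intros x [p Hp]. eapply Hn; eauto. }
  specialize (HC n). unfold e in *. lra.
Qed.

(** * Minimax *)

(** Jensen's inequality for a finite list, from binary mixtures alone: the head is mixed with the
    barycentre of the tail in proportion to their weights. Keeping the factor [total L] spares
    normalising the list. *)
Lemma weighted_combination {T S : Type} (P : T -> Prop) (Q : S -> Prop) (Phi : T -> S -> R)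
  (Hconv : forall t t' l, P t -> P t' -> 0 <= l <= 1 -> exists t'', P t'' /\
     forall s, Q s -> Phi t'' s <= l * Phi t s + (1 - l) * Phi t' s)
  (L : list (T * R)) :
  Forall (fun p => P (fst p) /\ 0 <= snd p) L -> 0 < total L ->
  exists t, P t /\ forall s, Q s -> total L * Phi t s <= fexp L (fun t => Phi t s).
Proof.
  intros HL. induction HL as [|[t p] L [Ht Hp] HL IH]; simpl in *; [lra|intros Hpos].
  assert (H0 : 0 <= total L) by now apply total_nonneg with P.
  destruct (Rle_lt_or_eq_dec _ _ H0) as [Hlt|Heq].
  - destruct (IH Hlt) as [t' [Ht' H']].
    destruct (Hconv t t' (p / (p + total L)) Ht Ht') as [t'' [Ht'' H'']].
    + split; [apply Rle_mult_inv_pos; lra|].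
      apply Rmult_le_reg_r with (p + total L); [lra|]. unfold Rdiv.
      rewrite Rmult_assoc, Rinv_l; lra.
    + exists t''. split; [auto|]. intros s Hs.
      apply Rle_trans with (p * Phi t s + total L * Phi t' s);
        [|specialize (H' s Hs); lra].
      replace (p * Phi t s + total L * Phi t' s) with
        ((p + total L) * (p / (p + total L) * Phi t s + (1 - p / (p + total L)) * Phi t' s))
        by (field; lra).
      apply Rmult_le_compat_l; [lra|auto].
  - exists t. split; [auto|]. intros s Hs. rewrite <- Heq.
    rewrite (fexp_total0 P L); auto. lra.
Qed.

(* A minimiser of the sum of the squared deficits has no deficit: otherwise moving a little
   towards a response to the test weighted by the deficits would decrease the sum. *)
Lemma minimax_finite {T S : Type} (P : T -> Prop) (Q : S -> Prop) (Phi : T -> S -> R) (B c : R)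
  (HB : forall t s, P t -> Q s -> Rabs (Phi t s) <= B)
  (Hconv : forall t t' l, P t -> P t' -> 0 <= l <= 1 -> exists t'', P t'' /\
     forall s, Q s -> Phi t'' s <= l * Phi t s + (1 - l) * Phi t' s)
  (Hconc : forall s s' l, Q s -> Q s' -> 0 <= l <= 1 -> exists s'', Q s'' /\
     forall t, P t -> l * Phi t s + (1 - l) * Phi t s' <= Phi t s'')
  (Hval : forall t, P t -> exists s, Q s /\ c <= Phi t s)
  (Hne : exists s, Q s) (L : list T) :
  Forall P L -> forall d, 0 < d -> exists s, Q s /\ Forall (fun t => c - d <= Phi t s) L.
Proof.
  intros HL d Hd.
  set (D := fun s t => Rmax 0 (c - Phi t s)).
  set (L1 := map (fun t => (t, 1)) L).
  assert (HL1 : Forall (fun p => P (fst p) /\ 0 <= snd p) L1).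
  { unfold L1. rewrite Forall_map. simpl. eapply Forall_impl; [|exact HL]. simpl. intros; split; [auto|lra]. }
  set (F := fun s => fexp L1 (fun t => (D s t)^2)).
  assert (HF0 : forall s, 0 <= F s).
  { intros s. apply fexp_nonneg with P; auto. intros. apply pow2_ge_0. }
  set (C := (B + Rabs c)^2 * total L1 + 1).
  assert (Hx : forall t s, P t -> Q s -> (Phi t s - c)^2 <= (B + Rabs c)^2).
  { intros t s Ht Hs. apply pow_maj_Rabs.
    pose proof (Rabs_triang (Phi t s) (- c)). rewrite Rabs_Ropp in H.
    specialize (HB t s Ht Hs). unfold Rminus. lra. }
  assert (Htot0 : 0 <= total L1) by now apply total_nonneg with P.
  assert (HC : 0 < C).
  { unfold C. pose proof (pow2_ge_0 (B + Rabs c)).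
    pose proof (Rmult_le_pos _ _ H Htot0). lra. }
  (* The response [s'] is good on average against the tests weighted by the deficits of [s], so in
     the expanded square the cross term, of order [l * (1 - l)], is not positive; [C] bounds what is
     left in [l^2]. *)
  assert (Hstep : forall s l, Q s -> 0 <= l <= 1 ->
    exists s'', Q s'' /\ F s'' <= (1 - l)^2 * F s + l^2 * C).
  { intros s l Hs Hl.
    set (Lw := map (fun t => (t, D s t)) L).
    assert (HLw : Forall (fun p => P (fst p) /\ 0 <= snd p) Lw).
    { unfold Lw. rewrite Forall_map. simpl. eapply Forall_impl; [|exact HL]. simpl.
      intros t Ht. split; [auto|apply Rmax_l]. }
    assert (Hw : forall h, fexp Lw h = fexp L1 (fun t => D s t * h t)).
    { intros h. unfold Lw, L1. clear. induction L as [|t L IH]; simpl; [reflexivity|].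
      rewrite IH. ring. }
    assert (Hresp : exists s', Q s' /\ 0 <= fexp L1 (fun t => D s t * (Phi t s' - c))).
    { assert (H0 : 0 <= total Lw) by now apply total_nonneg with P.
      destruct (Rle_lt_or_eq_dec _ _ H0) as [Hlt|Heq].
      - destruct (weighted_combination P Q Phi Hconv Lw HLw Hlt) as [t [Ht H]].
        destruct (Hval t Ht) as [s' [Hs' Hc]]. exists s'. split; [auto|].
        rewrite <- Hw. replace (fexp Lw (fun t => Phi t s' - c)) with
          (fexp Lw (fun t => 1 * Phi t s' + (- c) * 1)).
        + rewrite fexp_lin, fexp_const. specialize (H s' Hs').
          pose proof (Rmult_le_compat_l (total Lw) _ _ H0 Hc). lra.
        + apply fexp_ext with P; auto. intros; ring.
      - exists s. split; [auto|]. rewrite <- Hw.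
        rewrite (fexp_total0 P Lw); auto. lra. }
    destruct Hresp as [s' [Hs' Hr]].
    destruct (Hconc s s' (1 - l) Hs Hs') as [s'' [Hs'' H'']]; [lra|].
    exists s''. split; [auto|].
    apply Rle_trans with (fexp L1 (fun t => (1 - l)^2 * (D s t)^2 +
      1 * ((- 2 * (l * (1 - l))) * (D s t * (Phi t s' - c)) + l^2 * (B + Rabs c)^2 * 1))).
    - apply fexp_le with P; auto. intros t Ht. specialize (H'' t Ht).
      replace (1 - (1 - l)) with l in H'' by ring.
      set (x := Phi t s' - c). set (p := D s t).
      apply Rle_trans with (((1 - l) * p - l * x)^2).
      + assert (Hp : 0 <= p) by apply Rmax_l.
        assert (Hp' : c - Phi t s <= p) by apply Rmax_r.
        unfold D. destruct (Rle_dec (c - Phi t s'') 0) as [Hle|Hgt].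
        * rewrite Rmax_left by lra. rewrite pow_i by lia. apply pow2_ge_0.
        * rewrite Rmax_right by lra. apply pow_incr. split; [lra|].
          assert ((1 - l) * (c - Phi t s) <= (1 - l) * p) by (apply Rmult_le_compat_l; lra).
          unfold x. lra.
      + specialize (Hx t s' Ht Hs'). fold x in Hx.
        assert (l^2 * x^2 <= l^2 * (B + Rabs c)^2)
          by (apply Rmult_le_compat_l; [apply pow2_ge_0|auto]).
        nra.
    - rewrite fexp_lin, fexp_lin, fexp_const. unfold F, C.
      assert (0 <= 2 * (l * (1 - l)) * fexp L1 (fun t => D s t * (Phi t s' - c))).
      { apply Rmult_le_pos; [|auto]. apply Rmult_le_pos; [lra|]. apply Rmult_le_pos; lra. }
      pose proof (pow2_ge_0 l). lra. }
  assert (Hinf : exists s, Q s /\ F s < d^2).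
  { apply NNPP. intros Hno.
    set (M := isup (fun s : {s | Q s} => - F (proj1_sig s))).
    assert (HI : inhabited {s | Q s}) by (destruct Hne as [s Hs]; constructor; now exists s).
    assert (Hub : forall s : {s | Q s}, - F (proj1_sig s) <= - d^2).
    { intros [s Hs]. simpl. apply Rnot_lt_le. intros H. apply Hno. exists s. split; [auto|lra]. }
    assert (HM : M <= - d^2) by (apply isup_le with (- d^2); auto).
    set (m := - M).
    assert (Hm : 0 < m) by (assert (0 < d^2) by (apply pow_lt; lra); unfold m; lra).
    (* The infimum [m] need not be attained. This [l] minimises [(1 - l)^2 * m + l^2 * C], with
       value [m - l * m]; a point [s] within [l * m] of the infimum is therefore still moved
       strictly below [m]. *)
    set (l := m / (m + C)).
    assert (Hl : 0 < l <= 1).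
    { unfold l. split; [apply Rdiv_lt_0_compat; lra|].
      apply Rmult_le_reg_r with (m + C); [lra|]. unfold Rdiv.
      rewrite Rmult_assoc, Rinv_l; lra. }
    assert (Hlm : l * (m + C) = m) by (unfold l; field; lra).
    destruct (isup_approx (fun s : {s | Q s} => - F (proj1_sig s)) (- d^2) HI Hub (l * m))
      as [[s Hs] Hs']; [apply Rmult_lt_0_compat; lra|].
    simpl in Hs'. fold M in Hs'.
    destruct (Hstep s l Hs ltac:(lra)) as [s'' [Hs'' H'']].
    pose proof (isup_ub (fun s : {s | Q s} => - F (proj1_sig s)) (- d^2) HI Hub
      (exist _ s'' Hs'')) as Hm''. simpl in Hm''. fold M in Hm''.
    assert (Hfin : m <= (1 - l)^2 * F s + l^2 * C) by (unfold m; lra).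
    assert (F s < m + l * m) by (unfold m in *; lra).
    assert ((1 - l)^2 * F s <= (1 - l)^2 * (m + l * m))
      by (apply Rmult_le_compat_l; [apply pow2_ge_0|lra]).
    assert (E : l * (l * (m + C)) = l * m) by now rewrite Hlm.
    assert (0 < l * m) by (apply Rmult_lt_0_compat; lra).
    assert (0 < l * l * m) by (apply Rmult_lt_0_compat; [apply Rmult_lt_0_compat|]; lra).
    assert (l * (l * l * m) <= 1 * (l * l * m)) by (apply Rmult_le_compat_r; lra).
    nra. }
  destruct Hinf as [s [Hs HFs]]. exists s. split; [auto|].
  rewrite Forall_forall. intros t Ht. apply Rnot_lt_le. intros Hlt.
  assert (Hdt : d^2 <= (D s t)^2).
  { apply pow_incr. split; [lra|]. unfold D. rewrite Rmax_right; lra. }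
  assert (Hone : (D s t)^2 <= F s); [|lra].
  unfold F, L1. clear - Ht. induction L as [|z L IH]; [easy|]. simpl.
  assert (Hpos : 0 <= fexp (map (fun t => (t, 1)) L) (fun t => D s t * (D s t * 1))).
  { clear. induction L as [|t L IH]; simpl; [lra|]. pose proof (pow2_ge_0 (D s t)). nra. }
  destruct Ht as [->|Ht]; [lra|]. specialize (IH Ht). simpl in IH.
  pose proof (pow2_ge_0 (D s z)). lra.
Qed.

(** [Hnet] takes the place of compactness of the tests: a finite net suffices if it approximates
    uniformly in [s]. The three thirds of [d] pay for the approximate responses, the finite game and
    the passage from the net to all tests. *)
Lemma minimax {T S : Type} (P : T -> Prop) (Q : S -> Prop) (Phi : T -> S -> R) (B c : R)
  (HB : forall t s, P t -> Q s -> Rabs (Phi t s) <= B)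
  (Hconv : forall t t' l, P t -> P t' -> 0 <= l <= 1 -> exists t'', P t'' /\
     forall s, Q s -> Phi t'' s <= l * Phi t s + (1 - l) * Phi t' s)
  (Hconc : forall s s' l, Q s -> Q s' -> 0 <= l <= 1 -> exists s'', Q s'' /\
     forall t, P t -> l * Phi t s + (1 - l) * Phi t s' <= Phi t s'')
  (Hnet : forall d, 0 < d -> exists L, Forall P L /\ forall t, P t -> exists t', In t' L /\
     forall s, Q s -> Phi t' s - d <= Phi t s)
  (Hval : forall t d, P t -> 0 < d -> exists s, Q s /\ c - d <= Phi t s)
  (Hne : exists s, Q s) (d : R) :
  0 < d -> exists s, Q s /\ forall t, P t -> c - d <= Phi t s.
Proof.
  intros Hd. destruct (Hnet (d / 3)) as [L [HL HLn]]; [lra|].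
  destruct (minimax_finite P Q Phi B (c - d / 3) HB Hconv Hconc) with (L := L) (d := d / 3)
    as [s [Hs Hall]]; auto; [intros t Ht; apply Hval; auto; lra|lra|].
  exists s. split; [auto|]. intros t Ht. destruct (HLn t Ht) as [t' [Hin Ht']].
  rewrite Forall_forall in Hall. specialize (Hall t' Hin). specialize (Ht' s Hs). lra.
Qed.

(** * Total boundedness *)

(** The functions of [es] map [P] into a cube. By induction on [es]: the values of the first
    function are cut into slabs of width [d], and the induction hypothesis is applied inside each
    slab, which is why [P] is quantified after [es]. The net consists of elements of [P], so it
    inherits all their properties. *)
Lemma finite_net {T : Type} (es : list (T -> R)) (d : R) : 0 < d ->
  forall P : T -> Prop, (forall t e, P t -> In e es -> 0 <= e t <= 1) ->
  exists L, Forall P L /\ forall t, P t -> exists t', In t' L /\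
    forall e, In e es -> Rabs (e t - e t') <= d.
Proof.
  intros Hd. induction es as [|e es IH]; intros P HP.
  - destruct (classic (exists t, P t)) as [[t Ht]|Hno].
    + exists [t]. split; [now constructor|]. intros t' _. exists t. split; [now left|intros e []].
    + exists []. split; [constructor|]. intros t Ht. exfalso. apply Hno. now exists t.
  - assert (Hn : forall n : nat, exists L, Forall P L /\
      forall t, P t -> e t < INR n * d -> exists t', In t' L /\
      forall e', In e' (e :: es) -> Rabs (e' t - e' t') <= d).
    { induction n as [|n [L [HL HLn]]].
      - exists []. split; [constructor|]. simpl. intros t Ht H.
        pose proof (HP t e Ht (or_introl eq_refl)). lra.
      - destruct (IH (fun t => P t /\ INR n * d <= e t < INR (S n) * d)) as [L' [HL' HLn']].
        + intros t e' [Ht _] He'. apply HP; [auto|now right].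
        + exists (L ++ L'). split.
          * apply Forall_app. split; [auto|]. eapply Forall_impl; [|exact HL']. now intros t [].
          * intros t Ht Hlt. destruct (Rlt_dec (e t) (INR n * d)) as [H|H].
            -- destruct (HLn t Ht H) as [t' [Hin Ht']]. exists t'. split; [|auto].
               apply in_or_app. now left.
            -- destruct (HLn' t) as [t' [Hin Ht']]; [split; [auto|lra]|].
               exists t'. split; [apply in_or_app; now right|].
               intros e' [<-|He']; [|auto].
               rewrite Forall_forall in HL'. destruct (HL' t' Hin) as [_ H'].
               rewrite S_INR in *. apply Rabs_le. lra. }
    destruct (INR_unbounded (1 / d)) as [n Hnd]. destruct (Hn n) as [L [HL HLn]].
    exists L. split; [auto|]. intros t Ht. apply HLn; [auto|].
    pose proof (HP t e Ht (or_introl eq_refl)).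
    apply Rmult_lt_compat_r with (r := d) in Hnd; [|auto].
    unfold Rdiv in Hnd. rewrite Rmult_assoc, Rinv_l in Hnd; lra.
Qed.

Lemma common_threshold {T : Type} (Pr : R -> T -> Prop) (L : list T) :
  (forall a b t, 0 < b <= a -> Pr a t -> Pr b t) ->
  Forall (fun t => exists a, 0 < a /\ Pr a t) L -> exists a, 0 < a /\ Forall (Pr a) L.
Proof.
  intros Hmon HL. induction HL as [|t L [a [Ha Hat]] _ [b [Hb Hbl]]].
  - exists 1. split; [lra|constructor].
  - exists (Rmin a b). assert (0 < Rmin a b) by now apply Rmin_glb_lt.
    split; [auto|]. constructor.
    + apply Hmon with a; [|auto]. split; [auto|apply Rmin_l].
    + eapply Forall_impl; [|exact Hbl]. intros t'. apply Hmon. split; [auto|apply Rmin_r].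
Qed.

(** * Limits along an ultrafilter *)

(** One ultrafilter makes every bounded sequence converge, hence the integrals of all continuous
    functions simultaneously, with no extraction of subsequences. The first clause is freeness:
    cofinite sets are large. *)
Definition free_ultrafilter (U : (nat -> Prop) -> Prop) : Prop :=
  (forall P N, (forall n, (N <= n)%nat -> P n) -> U P) /\
  (forall P P', U P -> U P' -> U (fun n => P n /\ P' n)) /\
  (forall P P' : nat -> Prop, (forall n, P n -> P' n) -> U P -> U P') /\
  ~ U (fun _ => False) /\ (forall P, U P \/ U (fun n => ~ P n)).

Lemma free_ultrafilter_exists : exists U, free_ultrafilter U.
Proof.
  destruct (@filter.ultraFilterLemma nat filter.eventually filter.eventually_filter)
    as [U [HU HsU]].
  exists U. pose proof (@filter.ultra_proper _ _ HU) as Hp.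
  pose proof (@filter.filter_filter _ _ Hp) as Hf.
  repeat split.
  - intros P N HN. apply HsU. exists N; [exact I|].
    intros n Hn. apply HN. now apply (ssrbool.elimT (@ssrnat.leP N n)).
  - intros P P' HP HP'. exact (@filter.filterI _ U Hf P P' HP HP').
  - intros P P' HPP' HP. exact (@filter.filterS _ U Hf P P' HPP' HP).
  - exact (@filter.filter_not_empty _ U Hp).
  - intros P. destruct (@filter.in_ultra_setVsetC _ U P HU) as [H|H]; [now left|now right].
Qed.

Definition is_ulim (U : (nat -> Prop) -> Prop) (s : nat -> R) (l : R) : Prop :=
  forall e, 0 < e -> U (fun n => Rabs (s n - l) < e).

Section Ultralimits.
Context (U : (nat -> Prop) -> Prop) (HU : free_ultrafilter U).

Lemma ultra_ex P : U P -> exists n, P n.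
Proof.
  intros HP. apply NNPP. intros Hno. destruct HU as [_ [_ [Hs [H0 _]]]].
  apply H0. revert HP. apply Hs. intros n Hn. apply Hno. now exists n.
Qed.

Lemma ultra_Forall {T} (P : T -> nat -> Prop) (L : list T) :
  Forall (fun t => U (P t)) L -> U (fun n => Forall (fun t => P t n) L).
Proof.
  destruct HU as [Hc [Hi [Hs _]]].
  intros HL. induction HL as [|t L Ht _ IH].
  - apply Hc with 0%nat. intros; constructor.
  - eapply Hs; [|apply (Hi _ _ Ht IH)]. intros n []. now constructor.
Qed.

(** The limit is the supremum of the levels that [s] exceeds on a large set. Below it this is the
    definition; above it the dichotomy of the ultrafilter turns [not large] into
    [large complement]. *)
Lemma ulim_exists s B : (forall n, Rabs (s n) <= B) -> exists l, is_ulim U s l.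
Proof.
  intros HB. destruct HU as [Hc [Hi [Hs [H0 Hd]]]].
  destruct (completeness (fun r => U (fun n => r <= s n))) as [l [Hub Hlub]].
  - exists (B + 1). intros r Hr. apply Rnot_lt_le. intros Hlt.
    destruct (ultra_ex _ Hr) as [n Hn]. specialize (HB n). apply Rabs_bound in HB. lra.
  - exists (- B). apply Hc with 0%nat. intros n _. specialize (HB n). apply Rabs_bound in HB. lra.
  - exists l. intros e He.
    assert (H1 : U (fun n => l - e / 2 <= s n)).
    { apply NNPP. intros Hno.
      assert (l <= l - e / 2); [|lra]. apply Hlub. intros r Hr. apply Rnot_lt_le. intros Hlt.
      apply Hno. revert Hr. apply Hs. intros n Hn. lra. }
    assert (H2 : U (fun n => ~ (l + e / 2 <= s n))).
    { destruct (Hd (fun n => l + e / 2 <= s n)) as [H|H]; [|auto].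
      specialize (Hub _ H). lra. }
    eapply Hs; [|apply (Hi _ _ H1 H2)]. intros n [Ha Hb]. apply Rabs_def1; lra.
Qed.

Lemma ulim_unique s l l' : is_ulim U s l -> is_ulim U s l' -> l = l'.
Proof.
  intros H H'. destruct (Req_dec l l') as [|Hne]; [auto|exfalso].
  assert (He : 0 < Rabs (l - l') / 2).
  { assert (0 < Rabs (l - l')) by (apply Rabs_pos_lt; lra). lra. }
  destruct HU as [_ [Hi _]].
  destruct (ultra_ex _ (Hi _ _ (H _ He) (H' _ He))) as [n [Ha Hb]].
  assert (E : l - l' = - (s n - l) + (s n - l')) by ring.
  pose proof (Rabs_triang (- (s n - l)) (s n - l')) as Ht.
  rewrite Rabs_Ropp in Ht. rewrite <- E in Ht. lra.
Qed.

Lemma ulim_le s l c : is_ulim U s l -> (forall n, c <= s n) -> c <= l.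
Proof.
  intros H Hc. apply Rnot_lt_le. intros Hlt.
  destruct (ultra_ex _ (H (c - l) ltac:(lra))) as [n Hn].
  specialize (Hc n). apply Rabs_def2 in Hn. lra.
Qed.

Lemma ulim_ge s l c : is_ulim U s l -> (forall n, s n <= c) -> l <= c.
Proof.
  intros H Hc. apply Rnot_lt_le. intros Hlt.
  destruct (ultra_ex _ (H (l - c) ltac:(lra))) as [n Hn].
  specialize (Hc n). apply Rabs_def2 in Hn. lra.
Qed.

Lemma ulim_lin s s' l l' a b : is_ulim U s l -> is_ulim U s' l' ->
  is_ulim U (fun n => a * s n + b * s' n) (a * l + b * l').
Proof.
  intros H H' e He. destruct HU as [_ [Hi [Hs _]]].
  set (M := Rabs a + Rabs b + 1).
  assert (HM : 0 < M) by (pose proof (Rabs_pos a); pose proof (Rabs_pos b); unfold M; lra).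
  assert (HeM : 0 < e / M) by now apply Rdiv_lt_0_compat.
  eapply Hs; [|apply (Hi _ _ (H _ HeM) (H' _ HeM))]. intros n [Ha Hb].
  replace (a * s n + b * s' n - (a * l + b * l')) with (a * (s n - l) + b * (s' n - l')) by ring.
  eapply Rle_lt_trans; [apply Rabs_triang|]. rewrite !Rabs_mult.
  assert (Rabs a * Rabs (s n - l) <= Rabs a * (e / M))
    by (apply Rmult_le_compat_l; [apply Rabs_pos|lra]).
  assert (Rabs b * Rabs (s' n - l') <= Rabs b * (e / M))
    by (apply Rmult_le_compat_l; [apply Rabs_pos|lra]).
  assert (M * (e / M) = e) by (field; lra). unfold M in *. lra.
Qed.

End Ultralimits.

(** * Homogeneous Lipschitz functions *)

Lemma norm1_nonneg K p : 0 <= norm1 K p.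
Proof. apply sumK_nonneg. intros. apply Rabs_pos. Qed.

Lemma norm1_lin_scale K c a x b y :
  0 <= c -> norm1 K (lin (c * a) x (c * b) y) = c * norm1 K (lin a x b y).
Proof.
  intros Hc. unfold norm1, lin.
  transitivity (c * sumK K (fun k => Rabs (a * x k - b * y k)) + 0 * sumK K (fun _ => 0));
    [|ring].
  rewrite <- sumK_lin. apply sumK_ext. intros k _.
  replace (c * a * x k - c * b * y k) with (c * (a * x k - b * y k)) by ring.
  rewrite Rabs_mult, (Rabs_pos_eq c) by auto. ring.
Qed.

Lemma norm1_lin_triang K a x b y c z :
  norm1 K (lin a x c z) <= norm1 K (lin a x b y) + norm1 K (lin b y c z).
Proof.
  unfold norm1. replace (_ + _) with
    (1 * sumK K (fun k => Rabs (lin a x b y k)) + 1 * sumK K (fun k => Rabs (lin b y c z k))) by ring.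
  rewrite <- sumK_lin. apply sumK_le. intros k _. unfold lin.
  replace (a * x k - c * z k) with ((a * x k - b * y k) + (b * y k - c * z k)) by ring.
  rewrite !Rmult_1_l. apply Rabs_triang.
Qed.

Lemma norm1_lin_sym K a x b y : norm1 K (lin a x b y) = norm1 K (lin b y a x).
Proof. apply sumK_ext. intros k _. unfold lin. apply Rabs_minus_sym. Qed.

Lemma norm1_lin_0r K a x y : simplex K x -> 0 <= a -> norm1 K (lin a x 0 y) = a.
Proof.
  intros [H0 [_ H1]] Ha. unfold norm1, lin.
  rewrite (sumK_ext K _ (fun k => a * x k + 0 * x k)).
  - rewrite sumK_lin, H1. ring.
  - intros k Hk. rewrite Rabs_pos_eq; [ring|].
    pose proof (Rmult_le_pos _ _ Ha (H0 k Hk)). lra.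
Qed.

Lemma norm1_lin_11 K x y : norm1 K (lin 1 x 1 y) = norm1 K (fun k => x k - y k).
Proof. apply sumK_ext. intros k _. unfold lin. f_equal. ring. Qed.

(** The extension [a x |-> a * f x] to the cone over [X] is [c]-Lipschitz. For points of the
    simplex, taking [a] or [b] equal to 0 also yields [-c <= f <= c], so [c = 0] forces [f = 0]. *)
Definition hlip (K : nat) (X : pt -> Prop) (c : R) (f : pt -> R) : Prop :=
  forall x y a b, X x -> X y -> 0 <= a -> 0 <= b ->
    a * f x - b * f y <= c * norm1 K (lin a x b y).

Lemma hlip_lip K X f x y : hlip K X 1 f -> X x -> X y ->
  f x <= f y + norm1 K (fun k => x k - y k).
Proof.
  intros Hf Hx Hy. rewrite <- norm1_lin_11.
  specialize (Hf x y 1 1 Hx Hy ltac:(lra) ltac:(lra)). lra.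
Qed.

Lemma hlip_cont K X f : hlip K X 1 f -> cont_on K X f.
Proof.
  intros Hf x Hx e He. exists e. split; [auto|]. intros y Hy Hd.
  pose proof (hlip_lip K X f x y Hf Hx Hy) as H1.
  pose proof (hlip_lip K X f y x Hf Hy Hx) as H2.
  rewrite <- norm1_lin_11, norm1_lin_sym, norm1_lin_11 in H1. apply Rabs_def1; lra.
Qed.

(* McShane extension of the positively homogeneous function [b y |-> b * f y] from the cone
   over [X], restricted to the simplex. *)
Lemma D1_extension K X f x0 :
  (forall x, X x -> simplex K x) -> X x0 -> hlip K X 1 f ->
  exists F, D1 K F /\ forall x, X x -> F x = f x.
Proof.
  intros HX Hx0 Hf.
  set (I := {p : pt * R | X (fst p) /\ 0 <= snd p}).
  set (G := fun z (i : I) => snd (proj1_sig i) * f (fst (proj1_sig i))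
     - norm1 K (lin (snd (proj1_sig i)) (fst (proj1_sig i)) 1 z)).
  assert (HI : inhabited I) by (constructor; exists (x0, 0); simpl; split; [auto|lra]).
  (* Comparison with the apex of the cone: [b * f y <= b], while [b], the norm of [b y], is at most
     the distance from [b y] to [z] plus 1. *)
  assert (Hub : forall z i, simplex K z -> G z i <= 1).
  { intros z [[y b] [Hy Hb]] Hz. unfold G; simpl in *.
    pose proof (Hf y y b 0 Hy Hy Hb ltac:(lra)) as H.
    pose proof (norm1_lin_triang K b y 1 z 0 y) as Ht.
    rewrite (norm1_lin_0r K 1 z) in Ht by (auto; lra). lra. }
  set (F := fun z => isup (G z)).
  assert (HG : forall z i, simplex K z -> G z i <= F z).
  { intros z i Hz. apply isup_ub with 1; auto. }
  assert (Hlb : forall z, simplex K z -> - 1 <= F z).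
  { intros z Hz. assert (Hi : X (fst (x0, 0)) /\ 0 <= snd (x0, 0)) by (simpl; split; [auto|lra]).
    pose proof (HG z (exist _ (x0, 0) Hi) Hz) as H. unfold G in H; simpl in H.
    rewrite norm1_lin_sym, norm1_lin_0r in H by (auto; lra). lra. }
  assert (Hle1 : forall z, simplex K z -> F z <= 1) by (intros z Hz; apply isup_le with 1; auto).
  assert (HL : forall x y a b, simplex K x -> simplex K y -> 0 <= a -> 0 <= b ->
    a * F x - b * F y <= norm1 K (lin a x b y)).
  { intros x y a b Hx Hy Ha Hb.
    destruct (Rle_lt_or_eq_dec 0 a Ha) as [Ha'|<-].
    2:{ rewrite norm1_lin_sym, norm1_lin_0r by auto.
        pose proof (Rmult_le_compat_l b _ _ Hb (Hlb y Hy)). lra. }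
    destruct (Rle_lt_or_eq_dec 0 b Hb) as [Hb'|<-].
    2:{ rewrite norm1_lin_0r by auto.
        pose proof (Rmult_le_compat_l a _ _ Ha (Hle1 x Hx)). lra. }
    assert (HFx : F x <= (norm1 K (lin a x b y) + b * F y) / a).
    { apply isup_le with 1; auto. intros [[z c] [Hz Hc]].
      apply Rmult_le_reg_r with a; [auto|]. unfold Rdiv. rewrite Rmult_assoc, Rinv_l, Rmult_1_r by lra.
      simpl in Hz, Hc.
      (* The cone point [c z] that competes at [x] is rescaled by [a / b] to compete at [y]; after
         multiplication by [a] and by [b] respectively, both become [(a * c) z], and the triangle
         inequality applies. *)
      assert (Hi : X (fst (z, a * c / b)) /\ 0 <= snd (z, a * c / b)).
      { simpl. split; [auto|]. apply Rle_mult_inv_pos; [|auto]. now apply Rmult_le_pos. }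
      pose proof (HG y (exist _ (z, a * c / b) Hi) Hy) as H.
      apply (Rmult_le_compat_l b) in H; [|auto]. unfold G in *; simpl in *.
      pose proof (norm1_lin_scale K b (a * c / b) z 1 y Hb) as E1.
      pose proof (norm1_lin_scale K a c z 1 x Ha) as E2.
      replace (b * (a * c / b)) with (a * c) in E1 by (field; lra).
      rewrite Rmult_1_r in E1, E2.
      pose proof (norm1_lin_triang K (a * c) z a x b y) as Ht.
      assert (b * (a * c / b * f z) = a * c * f z) by (field; lra). nra. }
    apply (Rmult_le_compat_l a) in HFx; [|auto].
    replace (a * ((norm1 K (lin a x b y) + b * F y) / a)) with
      (norm1 K (lin a x b y) + b * F y) in HFx by (field; lra). lra. }
  exists F. split; [split; [|exact HL]|].
  - apply hlip_cont. intros x y a b Hx Hy Ha Hb. specialize (HL x y a b Hx Hy Ha Hb). lra.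
  - intros x Hx. apply Rle_antisym.
    + apply isup_le with 1; auto. intros [[y b] [Hy Hb]]. unfold G; simpl in *.
      pose proof (Hf y x b 1 Hy Hx Hb ltac:(lra)). lra.
    + assert (Hi : X (fst (x, 1)) /\ 0 <= snd (x, 1)) by (simpl; split; [auto|lra]).
      pose proof (HG x (exist _ (x, 1) Hi) (HX x Hx)) as H. unfold G in H; simpl in H.
      rewrite norm1_lin_11 in H.
      replace (norm1 K (fun k => x k - x k)) with 0 in H; [lra|].
      unfold norm1. rewrite (sumK_ext K _ (fun _ => 0)).
      * symmetry. apply sumK_zero.
      * intros k _. rewrite Rminus_diag. apply Rabs_R0.
Qed.

(** Coordinates of points of the simplex lie in [[0, 1]], so they can serve as the test functions of
    [finite_net]. The denominator [INR K + 1] shares [d] among the coordinates and is positive even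
    for [K = 0]. *)
Lemma simplex_net K X d :
  (forall x, X x -> simplex K x) -> 0 < d -> exists L, Forall X L /\
  forall x, X x -> exists z, In z L /\ norm1 K (fun k => x k - z k) <= d
    /\ norm1 K (fun k => z k - x k) <= d.
Proof.
  intros HX Hd. pose proof (pos_INR K).
  assert (Hd' : 0 < d / (INR K + 1)) by (apply Rdiv_lt_0_compat; lra).
  destruct (finite_net (map (fun k (x : pt) => x k) (seq 0 K)) _ Hd' X) as [L [HL Hnet]].
  - intros x e Hx He. apply in_map_iff in He. destruct He as [k [<- Hk]].
    apply in_seq in Hk. destruct (HX x Hx) as [H0 [_ H1]]. split; [apply H0; lia|].
    rewrite <- H1. assert (Hkn : exists n, K = (k + S n)%nat) by (exists (K - k - 1)%nat; lia).
    destruct Hkn as [n ->]. rewrite sumK_add, sumK_first, Nat.add_0_r.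
    pose proof (sumK_nonneg k x ltac:(intros; apply H0; lia)).
    pose proof (sumK_nonneg n (fun j => x (k + S j)%nat) ltac:(intros; apply H0; lia)). lra.
  - exists L. split; [auto|]. intros x Hx. destruct (Hnet x Hx) as [z [Hz Hzx]].
    exists z. split; [auto|].
    assert (Hs : forall f, (forall k, (k < K)%nat -> Rabs (f k) <= d / (INR K + 1)) -> norm1 K f <= d).
    { intros f Hf. apply Rle_trans with (sumK K (fun _ => d / (INR K + 1))).
      - now apply sumK_le.
      - assert (E : forall n c, sumK n (fun _ => c) = INR n * c).
        { intros n c. induction n as [|n IH]; [simpl; ring|].
          rewrite S_INR. simpl. rewrite IH. ring. }
        rewrite E. apply Rle_trans with ((INR K + 1) * (d / (INR K + 1))); [|right; field; lra].
        apply Rmult_le_compat_r; lra. }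
    assert (Hk : forall k, (k < K)%nat -> Rabs (x k - z k) <= d / (INR K + 1)).
    { intros k Hk. apply (Hzx (fun x => x k)). apply in_map_iff. exists k. split; [auto|].
      apply in_seq. lia. }
    split; apply Hs; [auto|]. intros k Hk'. rewrite Rabs_minus_sym. auto.
Qed.

(** * Continuous functions and probabilities on the compact set [X] *)

Lemma cont_bounded K X h : seq_compact K X -> cont_on K X h ->
  exists B, 0 <= B /\ forall x, X x -> Rabs (h x) <= B.
Proof.
  intros Hc Hh. apply NNPP. intros Hno.
  assert (Hx : forall n, exists x, X x /\ INR n < Rabs (h x)).
  { intros n. apply NNPP. intros Hn. apply Hno. exists (INR n). split; [apply pos_INR|].
    intros x Hx. apply Rnot_lt_le. intros Hlt. apply Hn. now exists x. }
  pose (u := fun n => proj1_sig (constructive_indefinite_description _ (Hx n))).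
  assert (Hu : forall n, X (u n) /\ INR n < Rabs (h (u n)))
    by (intros n; exact (proj2_sig (constructive_indefinite_description _ (Hx n)))).
  destruct (Hc u ltac:(apply Hu)) as [phi [Hphi [l [Hl Hcv]]]].
  destruct (Hh l Hl 1 ltac:(lra)) as [d [Hd Hld]].
  destruct (Hcv d Hd) as [N HN].
  assert (Hge : forall n, (n <= phi n)%nat).
  { induction n as [|n IH]; [lia|]. specialize (Hphi n). lia. }
  destruct (INR_unbounded (Rabs (h l) + 1)) as [n Hn].
  set (m := max n N). destruct (Hu (phi m)) as [Hm1 Hm2].
  pose proof (Hld _ Hm1 (HN m ltac:(lia))) as H1.
  pose proof (Rabs_triang (h l) (h (u (phi m)) - h l)) as H2.
  replace (h l + (h (u (phi m)) - h l)) with (h (u (phi m))) in H2 by ring.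
  assert (INR n <= INR (phi m)); [|lra].
  apply le_INR. specialize (Hge m). lia.
Qed.

Lemma cont_on_scal K X c h : cont_on K X h -> cont_on K X (fun x => c * h x).
Proof.
  intros Hh x Hx e He. pose proof (Rabs_pos c).
  destruct (Hh x Hx (e / (Rabs c + 1))) as [d [Hd H']]; [apply Rdiv_lt_0_compat; lra|].
  exists d. split; [auto|]. intros y Hy Hyx. specialize (H' y Hy Hyx).
  rewrite <- Rmult_minus_distr_l, Rabs_mult.
  apply Rle_lt_trans with ((Rabs c) * (e / (Rabs c + 1))).
  - apply Rmult_le_compat_l; lra.
  - apply Rlt_le_trans with ((Rabs c + 1) * (e / (Rabs c + 1))); [|right; field; lra].
    apply Rmult_lt_compat_r; [apply Rdiv_lt_0_compat|]; lra.
Qed.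

Lemma cont_on_plus K X h h' : cont_on K X h -> cont_on K X h' -> cont_on K X (fun x => h x + h' x).
Proof.
  intros Hh Hh' x Hx e He.
  destruct (Hh x Hx (e / 2)) as [d [Hd H1]]; [lra|].
  destruct (Hh' x Hx (e / 2)) as [d' [Hd' H2]]; [lra|].
  exists (Rmin d d'). split; [now apply Rmin_glb_lt|]. intros y Hy Hyx.
  pose proof (Rmin_l d d'). pose proof (Rmin_r d d').
  specialize (H1 y Hy ltac:(lra)). specialize (H2 y Hy ltac:(lra)).
  apply Rabs_def2 in H1, H2. apply Rabs_def1; lra.
Qed.

Lemma cont_on_const K X c : cont_on K X (fun _ => c).
Proof.
  intros x _ e He. exists 1. split; [lra|]. intros. rewrite Rminus_diag, Rabs_R0. lra.
Qed.

Lemma prob_le K X u h h' : is_prob K X u -> cont_on K X h -> cont_on K X h' ->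
  (forall x, X x -> h x <= h' x) -> u h <= u h'.
Proof.
  intros [Hadd [Hscal [Hpos _]]] Hh Hh' Hle.
  assert (Hc : cont_on K X (fun x => - 1 * h x)) by now apply cont_on_scal.
  pose proof (Hpos (fun x => h' x + - 1 * h x)) as H.
  rewrite (Hadd h' (fun x => - 1 * h x)), Hscal in H by auto.
  enough (0 <= u h' + - 1 * u h) by lra. apply H.
  - now apply cont_on_plus.
  - intros x Hx. specialize (Hle x Hx). lra.
Qed.

Lemma prob_const K X u c : is_prob K X u -> u (fun _ => c) = c.
Proof.
  intros [_ [Hscal [_ H1]]].
  replace (fun _ : pt => c) with (fun _ : pt => c * 1) by (extensionality x; ring).
  rewrite (Hscal c (fun _ => 1)), H1; [ring|apply cont_on_const].
Qed.

Lemma prob_emb K X u : is_fdist X u -> is_prob K X (emb u).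
Proof.
  intros [Hu Ht]. unfold emb. repeat split.
  - intros h h' _ _. replace (fun x => h x + h' x) with (fun x => 1 * h x + 1 * h' x)
      by (extensionality x; ring). rewrite fexp_lin. ring.
  - intros c h _. replace (fun x => c * h x) with (fun x => c * h x + 0 * h x)
      by (extensionality x; ring). rewrite fexp_lin. ring.
  - intros h _ Hh. now apply fexp_nonneg with X.
  - now rewrite <- total_fexp.
Qed.

Lemma isup_scal_le {I} (F : I -> R) M a C : inhabited I -> (forall i, F i <= M) ->
  0 <= a -> (forall i, a * F i <= C) -> a * isup F <= C.
Proof.
  intros HI HM Ha HC. destruct (Rle_lt_or_eq_dec 0 a Ha) as [Ha'|<-].
  - apply Rmult_le_reg_l with (/ a); [now apply Rinv_0_lt_compat|].
    rewrite <- Rmult_assoc, Rinv_l, Rmult_1_l by lra.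
    apply isup_le with M; auto. intros i.
    apply Rmult_le_reg_l with a; [auto|]. rewrite <- Rmult_assoc, Rinv_r, Rmult_1_l by lra. auto.
  - destruct HI as [i]. specialize (HC i). lra.
Qed.

Lemma common_index {T : Type} (Pr : nat -> T -> Prop) (L : list T) :
  (forall n m t, (n <= m)%nat -> Pr n t -> Pr m t) ->
  Forall (fun t => exists n, Pr n t) L -> exists n, Forall (Pr n) L.
Proof.
  intros Hmon HL. induction HL as [|t L [n Hn] _ [m Hm]].
  - exists 0%nat. constructor.
  - exists (max n m). constructor; [apply Hmon with n; [lia|auto]|].
    eapply Forall_impl; [|exact Hm]. intros t'. apply Hmon. lia.
Qed.

Lemma fexp_fnext {A} (q : pt -> A -> list (pt * R)) u s h :
  fexp (fnext q u s) h = fexp u (fun x => fexp (s x) (fun a => fexp (q x a) h)).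
Proof.
  unfold fnext. rewrite (fexp_flat_map (fun x => fexp (qmix q x (s x)) h)).
  - f_equal. extensionality x. unfold qmix.
    apply (fexp_flat_map (fun a => fexp (q x a) h)).
    intros e. apply (fexp_map _ (fun y => y)).
  - intros e. apply (fexp_map _ (fun y => y)).
Qed.

(** * Dynamic programming *)

Definition sh (theta : nat -> R) : nat -> R := fun n => theta (S n).

Fixpoint shn (m : nat) (theta : nat -> R) : nat -> R :=
  match m with O => theta | S k => sh (shn k theta) end.

Lemma shn_eq m theta n : shn m theta n = theta (m + n)%nat.
Proof.
  revert n. induction m as [|m IH]; intros n; simpl; [reflexivity|].
  unfold sh. rewrite IH. f_equal. lia.
Qed.

(** Unlike evaluations, this class is stable under the shift [sh]. Bounds on partial sums stand for
    the series; together with [full_mass] they say that the total mass is 1. *)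
Definition subeval (theta : nat -> R) : Prop :=
  (forall n, 0 <= theta n) /\ (forall n, sumK n theta <= 1).

Definition full_mass (theta : nat -> R) : Prop :=
  forall e, 0 < e -> exists n, 1 - e <= sumK n theta.

Definition impatience_le (theta : nat -> R) (al : R) : Prop :=
  forall n, sumK n (fun t => Rabs (theta (S t) - theta t)) <= al.

Lemma subeval_sh theta : subeval theta -> subeval (sh theta).
Proof.
  intros [H0 H1]. split; [intros n; apply H0|]. intros n.
  specialize (H1 (S n)). rewrite sumK_first in H1. specialize (H0 0%nat). unfold sh. lra.
Qed.

Lemma subeval_shn m theta : subeval theta -> subeval (shn m theta).
Proof. intros H. induction m; simpl; auto using subeval_sh. Qed.

Section MDP.
Context (K : nat) (X : pt -> Prop) (A : Type)
  (q : pt -> A -> list (pt * R)) (g : pt -> A -> R)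
  (HX : forall x, X x -> simplex K x) (HXc : seq_compact K X) (HA : inhabited A)
  (Hq : forall x a, X x -> is_fdist X (q x a))
  (Hg : forall x a, X x -> 0 <= g x a <= 1)
  (Hqf : forall x y a f al be, X x -> X y -> D1 K f -> 0 <= al -> 0 <= be ->
     Rabs (al * fexp (q x a) f - be * fexp (q y a) f) <= norm1 K (lin al x be y))
  (Hgl : forall x y a al be, X x -> X y -> 0 <= al -> 0 <= be ->
     Rabs (al * g x a - be * g y a) <= norm1 K (lin al x be y)).

Definition selection (s : pt -> list (A * R)) : Prop :=
  forall x, X x -> is_fdist (fun _ : A => True) (s x).

Definition bnd (M : R) (f : pt -> R) : Prop := forall x, X x -> 0 <= f x <= M.

(** Bellman operator with present weight [t0]. With [t0 = 0] it is the pure transition operator,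
    used below for excessive functions. *)
Definition bell (t0 : R) (f : pt -> R) (x : pt) : R :=
  isup (fun a => t0 * g x a + fexp (q x a) f).

Lemma fdist_fnext u s : is_fdist X u -> selection s -> is_fdist X (fnext q u s).
Proof.
  intros [Hu Ht] Hs. split.
  - apply Forall_flat_map_weight with X; [auto|]. intros [x p] Hx Hp. simpl in *.
    apply (Forall_map_weight X X _ (fun y => y)); auto.
    apply Forall_flat_map_weight with (fun _ => True); [apply Hs; auto|].
    intros [a r] _ Hr. apply (Forall_map_weight X X _ (fun y => y)); auto. apply Hq; auto.
  - rewrite total_fexp, fexp_fnext. transitivity (fexp u (fun _ => 1)).
    + apply fexp_ext with X; [auto|]. intros x Hx. destruct (Hs x Hx) as [Hsx Hst].
      transitivity (fexp (s x) (fun _ => 1)); [|now rewrite <- total_fexp].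
      apply fexp_ext with (fun _ => True); auto.
      intros a _. rewrite <- total_fexp. apply Hq; auto.
    + now rewrite <- total_fexp.
Qed.

Section Bellman.
Context (t0 : R) (f : pt -> R) (M : R) (Ht0 : 0 <= t0) (Hf : bnd M f).

Lemma payoff_bounds x a : X x -> 0 <= t0 * g x a + fexp (q x a) f <= t0 + M.
Proof.
  intros Hx. pose proof (Hg x a Hx).
  pose proof (fexp_ge_const X (q x a) f 0 (Hq x a Hx) ltac:(apply Hf)).
  pose proof (fexp_le_const X (q x a) f M (Hq x a Hx) ltac:(apply Hf)). nra.
Qed.

Lemma bell_ge x a : X x -> t0 * g x a + fexp (q x a) f <= bell t0 f x.
Proof. intros Hx. apply (isup_ub (fun a => t0 * g x a + fexp (q x a) f) (t0 + M)); auto. intros b. now apply payoff_bounds. Qed.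

Lemma bell_le x C : X x -> (forall a, t0 * g x a + fexp (q x a) f <= C) -> bell t0 f x <= C.
Proof. intros Hx. apply isup_le with (t0 + M); auto. intros b. now apply payoff_bounds. Qed.

Lemma bell_bnd : bnd (t0 + M) (bell t0 f).
Proof.
  intros x Hx. split.
  - destruct HA as [a]. apply Rle_trans with (t0 * g x a + fexp (q x a) f);
      [now apply payoff_bounds|now apply bell_ge].
  - apply bell_le; [auto|]. intros a. now apply payoff_bounds.
Qed.

Lemma bell_approx x e : X x -> 0 < e -> exists a, bell t0 f x - e < t0 * g x a + fexp (q x a) f.
Proof.
  intros Hx. apply (isup_approx (fun a => t0 * g x a + fexp (q x a) f) (t0 + M)); auto. intros b. now apply payoff_bounds. Qed.

Lemma bell_selection u s : is_fdist X u -> selection s ->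
  t0 * fpay g u s + fexp (fnext q u s) f <= fexp u (bell t0 f).
Proof.
  intros [Hu _] Hs. unfold fpay.
  replace (fexp (fnext q u s) f) with (1 * fexp (fnext q u s) f) by ring.
  rewrite fexp_fnext, <- fexp_lin. apply fexp_le with X; [auto|]. intros x Hx.
  rewrite <- fexp_lin. apply fexp_le_const with (fun _ => True); [auto|]. intros a _.
  rewrite Rmult_1_l. now apply bell_ge.
Qed.

End Bellman.

(** [f / c] extends to a function of [D1], to which the hypothesis on [q] applies. For [c = 0],
    where one cannot divide, [f] vanishes on [X]. *)
Lemma hlip_fexp_q c f x y a b al : hlip K X c f -> 0 <= c -> X x -> X y -> 0 <= a -> 0 <= b ->
  a * fexp (q x al) f - b * fexp (q y al) f <= c * norm1 K (lin a x b y).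
Proof.
  intros Hf Hc Hx Hy Ha Hb. destruct (Rle_lt_or_eq_dec 0 c Hc) as [Hc'|<-].
  - destruct (D1_extension K X (fun z => / c * f z) x HX Hx) as [F [HF HFf]].
    { intros x' y' a' b' Hx' Hy' Ha' Hb'. specialize (Hf x' y' a' b' Hx' Hy' Ha' Hb').
      apply Rmult_le_reg_l with c; [auto|].
      replace (c * (a' * (/ c * f x') - b' * (/ c * f y'))) with (a' * f x' - b' * f y')
        by (field; lra). lra. }
    assert (E : forall z, X z -> fexp (q z al) f = c * fexp (q z al) F).
    { intros z Hz. replace (c * fexp (q z al) F) with (c * fexp (q z al) F + 0 * fexp (q z al) F)
        by ring. rewrite <- fexp_lin. apply fexp_ext with X; [apply Hq; auto|].
      intros w Hw. rewrite HFf by auto. field. lra. }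
    rewrite !E by auto.
    pose proof (Rabs_bound _ _ (Hqf x y al F a b Hx Hy HF Ha Hb)) as [_ H].
    apply (Rmult_le_compat_l c) in H; lra.
  - assert (E : forall z, X z -> fexp (q z al) f = 0).
    { intros z Hz. rewrite (fexp_ext X (q z al) f (fun _ => 0)); [|apply Hq; auto|].
      - rewrite fexp_const. ring.
      - intros w Hw. pose proof (Hf w w 1 0 Hw Hw ltac:(lra) ltac:(lra)).
        pose proof (Hf w w 0 1 Hw Hw ltac:(lra) ltac:(lra)). lra. }
    rewrite !E by auto. lra.
Qed.

Lemma bell_hlip t0 f M c : 0 <= t0 -> 0 <= c -> bnd M f -> hlip K X c f ->
  hlip K X (t0 + c) (bell t0 f).
Proof.
  intros Ht0 Hc HM Hf x y a b Hx Hy Ha Hb.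
  enough (a * bell t0 f x <= b * bell t0 f y + (t0 + c) * norm1 K (lin a x b y)) by lra.
  apply isup_scal_le with (t0 + M); auto; [intros i; now apply payoff_bounds|].
  intros al.
  pose proof (hlip_fexp_q c f x y a b al Hf Hc Hx Hy Ha Hb) as H1.
  pose proof (Rabs_bound _ _ (Hgl x y al a b Hx Hy Ha Hb)) as [_ H2].
  apply (Rmult_le_compat_l t0) in H2; [|auto].
  pose proof (Rmult_le_compat_l b _ _ Hb (bell_ge t0 f M Ht0 HM y al Hy)). lra.
Qed.

Lemma bell_mono t0 t1 f f' M M' d x : 0 <= t0 -> 0 <= t1 -> bnd M f -> bnd M' f' ->
  (forall z, X z -> f z <= f' z + d) -> X x ->
  bell t0 f x <= bell t1 f' x + (Rabs (t0 - t1) + d).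
Proof.
  intros Ht0 Ht1 Hf Hf' Hle Hx. apply bell_le with M; auto. intros a.
  pose proof (bell_ge t1 f' M' Ht1 Hf' x a Hx).
  pose proof (fexp_le_plus X (q x a) f f' d (Hq x a Hx) Hle).
  pose proof (Hg x a Hx). pose proof (Rle_abs (t0 - t1)). pose proof (Rabs_pos (t0 - t1)).
  assert ((t0 - t1) * g x a <= Rabs (t0 - t1)); [|lra].
  apply Rle_trans with (Rabs (t0 - t1) * g x a); [apply Rmult_le_compat_r; lra|nra].
Qed.

Fixpoint Vn (theta : nat -> R) (n : nat) : pt -> R :=
  match n with O => fun _ => 0 | S m => bell (theta 0%nat) (Vn (sh theta) m) end.

Lemma Vn_bnd theta n : (forall n, 0 <= theta n) -> bnd (sumK n theta) (Vn theta n).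
Proof.
  revert theta. induction n as [|n IH]; intros theta H; [intros x _; simpl; lra|].
  rewrite sumK_first. apply bell_bnd; [auto|]. apply IH. intros k. apply H.
Qed.

Lemma Vn_hlip theta n : (forall n, 0 <= theta n) -> hlip K X (sumK n theta) (Vn theta n).
Proof.
  revert theta. induction n as [|n IH]; intros theta H; [intros x y a b _ _ _ _; simpl; lra|].
  rewrite sumK_first. assert (H' : forall n, 0 <= sh theta n) by (intros k; apply H).
  apply bell_hlip with (sumK n (sh theta)); auto.
  - apply sumK_nonneg. auto.
  - now apply Vn_bnd.
Qed.

Lemma Vn_mono theta n x : (forall n, 0 <= theta n) -> X x -> Vn theta n x <= Vn theta (S n) x.
Proof.
  revert theta x. induction n as [|n IH]; intros theta x H Hx.
  - apply (Vn_bnd theta 1 H x Hx).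
  - assert (H' : forall n, 0 <= sh theta n) by (intros k; apply H).
    change (bell (theta 0%nat) (Vn (sh theta) n) x <=
      bell (theta 0%nat) (Vn (sh theta) (S n)) x).
    replace (bell (theta 0%nat) (Vn (sh theta) (S n)) x) with
      (bell (theta 0%nat) (Vn (sh theta) (S n)) x + (Rabs (theta 0%nat - theta 0%nat) + 0))
      by (rewrite Rminus_diag, Rabs_R0; ring).
    apply bell_mono with (sumK n (sh theta)) (sumK (S n) (sh theta)); auto using Vn_bnd.
    intros z Hz. rewrite Rplus_0_r. auto.
Qed.

Lemma Vn_diff theta theta' n x : (forall n, 0 <= theta n) -> (forall n, 0 <= theta' n) -> X x ->
  Vn theta n x <= Vn theta' n x + sumK n (fun t => Rabs (theta t - theta' t)).
Proof.
  revert theta theta' x. induction n as [|n IH]; intros theta theta' x H H' Hx; [simpl; lra|].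
  rewrite sumK_first.
  assert (Hs : forall n, 0 <= sh theta n) by (intros k; apply H).
  assert (Hs' : forall n, 0 <= sh theta' n) by (intros k; apply H').
  apply bell_mono with (sumK n (sh theta)) (sumK n (sh theta')); auto using Vn_bnd.
Qed.

(** For a fixed play the payoff is linear in the evaluation, and a supremum of linear functions is
    convex; the recursion carries this through each Bellman step. *)
Lemma Vn_convex theta theta' l n x :
  (forall n, 0 <= theta n) -> (forall n, 0 <= theta' n) -> 0 <= l <= 1 -> X x ->
  Vn (fun t => l * theta t + (1 - l) * theta' t) n x <= l * Vn theta n x + (1 - l) * Vn theta' n x.
Proof.
  intros H H' Hl. revert theta theta' x H H'.
  induction n as [|n IH]; intros theta theta' x H H' Hx; [simpl; lra|].
  assert (Hs : forall n, 0 <= sh theta n) by (intros k; apply H).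
  assert (Hs' : forall n, 0 <= sh theta' n) by (intros k; apply H').
  set (th := fun t => l * theta t + (1 - l) * theta' t).
  assert (Hth : forall n, 0 <= th n) by (intros k; unfold th; specialize (H k); specialize (H' k); nra).
  change (bell (th 0%nat) (Vn (sh th) n) x <= l * bell (theta 0%nat) (Vn (sh theta) n) x +
    (1 - l) * bell (theta' 0%nat) (Vn (sh theta') n) x).
  apply bell_le with (sumK n (sh th)); auto.
  - apply Vn_bnd. intros k. apply Hth.
  - intros a.
    pose proof (bell_ge _ _ _ (H 0%nat) (Vn_bnd (sh theta) n Hs) x a Hx) as H1.
    pose proof (bell_ge _ _ _ (H' 0%nat) (Vn_bnd (sh theta') n Hs') x a Hx) as H2.
    assert (H3 : fexp (q x a) (Vn (sh th) n) <=
      l * fexp (q x a) (Vn (sh theta) n) + (1 - l) * fexp (q x a) (Vn (sh theta') n)).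
    { rewrite <- fexp_lin. apply fexp_le with X; [apply Hq; auto|]. intros z Hz. now apply IH. }
    apply (Rmult_le_compat_l l) in H1; [|lra]. apply (Rmult_le_compat_l (1 - l)) in H2; [|lra].
    change (th 0%nat) with (l * theta 0%nat + (1 - l) * theta' 0%nat). lra.
Qed.

(** A supremum over horizons rather than over strategies: payoffs being nonnegative, [Vn] increases
    with [n]. Strategies are compared with it only later, in [strategy_le_V] and
    [patient_strategies]. *)
Definition V (theta : nat -> R) (x : pt) : R := isup (fun n => Vn theta n x).

Section Value.
Context (theta : nat -> R) (Hth : subeval theta).

Lemma Vn_le1 n x : X x -> Vn theta n x <= 1.
Proof.
  intros Hx. destruct Hth as [H0 H1].
  apply Rle_trans with (sumK n theta); [apply Vn_bnd; auto|auto].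
Qed.

Lemma Vn_le_V n x : X x -> Vn theta n x <= V theta x.
Proof.
  intros Hx. apply (isup_ub (fun n => Vn theta n x) 1); [exact (inhabits 0%nat)|].
  intros i. now apply Vn_le1.
Qed.

Lemma V_le C x : X x -> (forall n, Vn theta n x <= C) -> V theta x <= C.
Proof.
  intros Hx. apply isup_le with 1; [exact (inhabits 0%nat)|]. intros i. now apply Vn_le1.
Qed.

Lemma V_bnd M : (forall n, sumK n theta <= M) -> bnd M (V theta).
Proof.
  intros HM x Hx. split; [apply (Vn_le_V 0 x Hx)|]. apply V_le; [auto|]. intros n.
  apply Rle_trans with (sumK n theta); [|auto]. apply Vn_bnd; [apply Hth|auto].
Qed.

Lemma V_bnd1 : bnd 1 (V theta).
Proof. apply V_bnd. apply Hth. Qed.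

Lemma V_hlip : hlip K X 1 (V theta).
Proof.
  intros x y a b Hx Hy Ha Hb.
  enough (a * V theta x <= b * V theta y + 1 * norm1 K (lin a x b y)) by lra.
  apply isup_scal_le with 1; [exact (inhabits 0%nat)|intros; now apply Vn_le1|auto|].
  intros n. pose proof (Vn_hlip theta n (proj1 Hth) x y a b Hx Hy Ha Hb).
  pose proof (Rmult_le_compat_l b _ _ Hb (Vn_le_V n y Hy)).
  pose proof (Rmult_le_compat_r _ _ _ (norm1_nonneg K (lin a x b y)) (proj2 Hth n)). lra.
Qed.

End Value.

(** One half of the Bellman equation in infinite horizon: the supremum over horizons commutes with
    the finite expectation under [q x a]. The other half, up to [e], is [V_approx]. *)
Lemma V_step theta x a : subeval theta -> X x ->
  theta 0%nat * g x a + fexp (q x a) (V (sh theta)) <= V theta x.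
Proof.
  intros Hth Hx. pose proof (subeval_sh theta Hth) as Hsh.
  enough (fexp (q x a) (V (sh theta)) <= V theta x - theta 0%nat * g x a) by lra.
  apply (fexp_isup X (Vn (sh theta)) 1); [apply Hq; auto| | |].
  - intros n z Hz. apply Vn_mono; [apply Hsh|auto].
  - intros n z Hz. now apply Vn_le1.
  - intros n. pose proof (Vn_le_V theta Hth (S n) x Hx) as H.
    pose proof (bell_ge _ _ _ (proj1 Hth 0%nat) (Vn_bnd (sh theta) n (proj1 Hsh)) x a Hx).
    simpl in H. lra.
Qed.

Lemma V_approx theta x e : subeval theta -> X x -> 0 < e ->
  exists a, V theta x - e <= theta 0%nat * g x a + fexp (q x a) (V (sh theta)).
Proof.
  intros Hth Hx He. pose proof (subeval_sh theta Hth) as Hsh.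
  destruct (isup_approx (fun n => Vn theta n x) 1 (inhabits 0%nat)
    (fun n => Vn_le1 theta Hth n x Hx) (e / 2)) as [[|n] Hn]; [lra| |];
    fold (V theta x) in Hn.
  (* Horizon 0 is already almost optimal, so [V theta x < e / 2] and any action will do. *)
  - simpl in Hn. destruct HA as [a]. exists a.
    pose proof (payoff_bounds _ _ 1 (proj1 Hth 0%nat) (V_bnd1 _ Hsh) x a Hx). lra.
  - destruct (bell_approx _ _ _ (proj1 Hth 0%nat) (Vn_bnd (sh theta) n (proj1 Hsh)) x (e / 2) Hx)
      as [a Ha]; [lra|].
    exists a. simpl in Hn.
    assert (fexp (q x a) (Vn (sh theta) n) <= fexp (q x a) (V (sh theta))); [|lra].
    apply fexp_le with X; [apply Hq; auto|]. intros z Hz. now apply Vn_le_V.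
Qed.

Lemma V_selection theta u s : subeval theta -> is_fdist X u -> selection s ->
  theta 0%nat * fpay g u s + fexp (fnext q u s) (V (sh theta)) <= fexp u (V theta).
Proof.
  intros Hth Hu Hs. pose proof (subeval_sh theta Hth) as Hsh.
  eapply Rle_trans; [apply (bell_selection _ _ 1 (proj1 Hth 0%nat) (V_bnd1 _ Hsh)); auto|].
  apply fexp_le with X; [apply Hu|]. intros x Hx. apply bell_le with 1; auto using V_bnd1.
  - apply Hth.
  - intros a. now apply V_step.
Qed.

Lemma V_diff theta theta' D x : subeval theta -> subeval theta' -> X x ->
  (forall n, sumK n (fun t => Rabs (theta t - theta' t)) <= D) -> V theta x <= V theta' x + D.
Proof.
  intros Hth Hth' Hx HD. apply V_le; auto. intros n.
  pose proof (Vn_diff theta theta' n x (proj1 Hth) (proj1 Hth') Hx).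
  pose proof (Vn_le_V theta' Hth' n x Hx). specialize (HD n). lra.
Qed.

Lemma V_convex theta theta' l x : subeval theta -> subeval theta' -> 0 <= l <= 1 -> X x ->
  subeval (fun t => l * theta t + (1 - l) * theta' t) ->
  V (fun t => l * theta t + (1 - l) * theta' t) x <= l * V theta x + (1 - l) * V theta' x.
Proof.
  intros Hth Hth' Hl Hx Hmix. apply V_le; auto. intros n.
  pose proof (Vn_convex theta theta' l n x (proj1 Hth) (proj1 Hth') Hl Hx).
  pose proof (Vn_le_V theta Hth n x Hx). pose proof (Vn_le_V theta' Hth' n x Hx). nra.
Qed.

(** * Excessive majorants and the lower bound *)

Definition F01 (f : pt -> R) : Prop := hlip K X 1 f /\ bnd 1 f.

(** Optimal stopping: [Tn m f] is the value when the reward [f] is collected after at most [m]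
    controlled moves, and its supremum [W f] is the Snell envelope of [f]. *)
Definition Top (f : pt -> R) (x : pt) : R := Rmax (f x) (bell 0 f x).

Definition Tn (m : nat) (f : pt -> R) : pt -> R := Nat.iter m Top f.

Definition W (f : pt -> R) (x : pt) : R := isup (fun m => Tn m f x).

Lemma Top_F01 f : F01 f -> F01 (Top f).
Proof.
  intros [HL HB]. split.
  - intros x y a b Hx Hy Ha Hb. unfold Top.
    pose proof (HL x y a b Hx Hy Ha Hb) as H1.
    pose proof (bell_hlip 0 f 1 1 ltac:(lra) ltac:(lra) HB HL x y a b Hx Hy Ha Hb) as H2.
    pose proof (Rmult_le_compat_l b _ _ Hb (Rmax_l (f y) (bell 0 f y))).
    pose proof (Rmult_le_compat_l b _ _ Hb (Rmax_r (f y) (bell 0 f y))).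
    destruct (Rmax_case_strong (f x) (bell 0 f x) (fun r => r = f x \/ r = bell 0 f x)) as [E|E];
      auto; rewrite E; lra.
  - intros x Hx. unfold Top. pose proof (HB x Hx).
    pose proof (bell_bnd 0 f 1 ltac:(lra) HB x Hx).
    split; [eapply Rle_trans; [|apply Rmax_l]; lra|apply Rmax_lub; lra].
Qed.

Lemma Tn_F01 m f : F01 f -> F01 (Tn m f).
Proof. intros H. induction m; [auto|]. now apply Top_F01. Qed.

Lemma Tn_mono f n m x : (n <= m)%nat -> Tn n f x <= Tn m f x.
Proof.
  intros Hnm. induction Hnm as [|m _ IH]; [lra|]. eapply Rle_trans; [exact IH|]. apply Rmax_l.
Qed.

Lemma Tn_nonexp f f' d m x : F01 f -> F01 f' -> 0 <= d ->
  (forall z, X z -> f z <= f' z + d) -> X x -> Tn m f x <= Tn m f' x + d.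
Proof.
  intros Hf Hf' Hd Hle. revert x. induction m as [|m IH]; intros x Hx; [now apply Hle|].
  change (Rmax (Tn m f x) (bell 0 (Tn m f) x) <= Rmax (Tn m f' x) (bell 0 (Tn m f') x) + d).
  pose proof (Rmax_l (Tn m f' x) (bell 0 (Tn m f') x)).
  pose proof (Rmax_r (Tn m f' x) (bell 0 (Tn m f') x)).
  pose proof (bell_mono 0 0 (Tn m f) (Tn m f') 1 1 d x ltac:(lra) ltac:(lra)
    (proj2 (Tn_F01 m f Hf)) (proj2 (Tn_F01 m f' Hf')) IH Hx) as H1.
  rewrite Rminus_diag, Rabs_R0 in H1. specialize (IH x Hx). apply Rmax_lub; lra.
Qed.

Lemma Tn_le_W f m x : F01 f -> X x -> Tn m f x <= W f x.
Proof.
  intros Hf Hx. apply (isup_ub (fun m => Tn m f x) 1 (inhabits 0%nat)).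
  intros i. now apply Tn_F01.
Qed.

Lemma W_le f C x : F01 f -> X x -> (forall m, Tn m f x <= C) -> W f x <= C.
Proof.
  intros Hf Hx. apply isup_le with 1; [exact (inhabits 0%nat)|]. intros i. now apply Tn_F01.
Qed.

Lemma W_F01 f : F01 f -> F01 (W f).
Proof.
  intros Hf. split.
  - intros x y a b Hx Hy Ha Hb.
    enough (a * W f x <= b * W f y + 1 * norm1 K (lin a x b y)) by lra.
    apply isup_scal_le with 1; [exact (inhabits 0%nat)|intros; now apply Tn_F01|auto|].
    intros m. pose proof (proj1 (Tn_F01 m f Hf) x y a b Hx Hy Ha Hb).
    pose proof (Rmult_le_compat_l b _ _ Hb (Tn_le_W f m y Hf Hy)). lra.
  - intros x Hx. split.
    + eapply Rle_trans; [|apply (Tn_le_W f 0 x Hf Hx)]. now apply Hf.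
    + apply W_le; auto. intros m. now apply Tn_F01.
Qed.

Lemma W_excessive f x a : F01 f -> X x -> fexp (q x a) (W f) <= W f x.
Proof.
  intros Hf Hx. apply (fexp_isup X (fun m => Tn m f) 1); [apply Hq; auto| | |].
  - intros n z Hz. apply Tn_mono. lia.
  - intros n z Hz. now apply Tn_F01.
  - intros n. apply Rle_trans with (Tn (S n) f x); [|now apply Tn_le_W].
    apply Rle_trans with (bell 0 (Tn n f) x); [|apply Rmax_r].
    pose proof (bell_ge 0 (Tn n f) 1 ltac:(lra) (proj2 (Tn_F01 n f Hf)) x a Hx). lra.
Qed.

(** For a single [f] and [x] the increasing sequence [Tn m f x] comes close to its supremum. Both
    [F01] and [X] are totally bounded and [Tn] is nonexpansive in [f] and Lipschitz in [x], so one
    index for a finite product of nets serves everywhere. *)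
Lemma W_uniform e : 0 < e -> exists M, forall f x, F01 f -> X x -> W f x <= Tn M f x + e.
Proof.
  (* Functions that agree within [d] on the net of points differ by at most [3 * d] on [X]. Passing
     from [f] to [f'] and back costs [6 * d], from [x] to [z] and back [2 * d], and the common index
     [d]. *)
  intros He. set (d := e / 9). assert (Hd : 0 < d) by (unfold d; lra).
  destruct (simplex_net K X d HX Hd) as [Lx [HLx Hnx]].
  destruct (finite_net (map (fun z (f : pt -> R) => f z) Lx) d Hd F01) as [Lf [HLf Hnf]].
  { intros f ev Hf Hev. apply in_map_iff in Hev. destruct Hev as [z [<- Hz]].
    rewrite Forall_forall in HLx. apply Hf. auto. }
  destruct (common_index (fun m p => W (fst p) (snd p) <= Tn m (fst p) (snd p) + d)
    (list_prod Lf Lx)) as [M HM].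
  { intros n m [f x] Hnm H. simpl in *. pose proof (Tn_mono f n m x Hnm). lra. }
  { rewrite Forall_forall in *. intros [f x] Hin. apply in_prod_iff in Hin. simpl.
    destruct (isup_approx (fun m => Tn m f x) 1 (inhabits 0%nat)) with (e := d) as [m Hm]; auto.
    - intros m. apply Tn_F01; [apply HLf|apply HLx]; tauto.
    - exists m. fold (W f x) in Hm. lra. }
  exists M. intros f x Hf Hx. rewrite Forall_forall in *.
  destruct (Hnf f Hf) as [f' [Hf'in Hff']]. destruct (Hnx x Hx) as [z [Hz [Hxz Hzx]]].
  pose proof (HLf f' Hf'in) as Hf'. pose proof (HLx z Hz) as Xz.
  assert (Hclose : forall y, X y -> f y <= f' y + 3 * d /\ f' y <= f y + 3 * d).
  { intros y Hy. destruct (Hnx y Hy) as [y' [Hy' [H1 H2]]].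
    pose proof (HLx y' Hy') as Xy'.
    pose proof (Rabs_bound _ _ (Hff' (fun f => f y') (in_map _ _ _ Hy'))).
    pose proof (hlip_lip K X f y y' (proj1 Hf) Hy Xy').
    pose proof (hlip_lip K X f y' y (proj1 Hf) Xy' Hy).
    pose proof (hlip_lip K X f' y y' (proj1 Hf') Hy Xy').
    pose proof (hlip_lip K X f' y' y (proj1 Hf') Xy' Hy). lra. }
  apply W_le; auto. intros m.
  pose proof (Tn_nonexp f f' (3 * d) m x Hf Hf' ltac:(lra) ltac:(apply Hclose) Hx).
  pose proof (Tn_nonexp f' f (3 * d) M x Hf' Hf ltac:(lra) ltac:(apply Hclose) Hx).
  pose proof (hlip_lip K X _ x z (proj1 (Tn_F01 m f' Hf')) Hx Xz).
  pose proof (hlip_lip K X _ z x (proj1 (Tn_F01 M f' Hf')) Xz Hx).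
  pose proof (Tn_le_W f' m z Hf' Xz).
  pose proof (HM (f', z) (in_prod _ _ _ _ Hf'in Hz)) as HMz. simpl in HMz.
  unfold d in *. lra.
Qed.

Lemma V_F01 theta : subeval theta -> F01 (V theta).
Proof. intros H. split; [now apply V_hlip|now apply V_bnd1]. Qed.

(** Making a move before the evaluation starts is like starting it one stage late: [V theta] is
    replaced by [V (sh theta)], at a cost bounded by the impatience, after which [V_step] returns to
    [V theta] because the payoff dropped is nonnegative. *)
Lemma V_ge_Tn theta al m x : subeval theta -> impatience_le theta al -> X x ->
  Tn m (V theta) x <= V theta x + INR m * al.
Proof.
  intros Hth Himp Hx. pose proof (subeval_sh theta Hth) as Hsh.
  assert (Hal : 0 <= al) by apply (Himp 0%nat).
  revert x Hx. induction m as [|m IH]; intros x Hx; [simpl; lra|].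
  rewrite S_INR. apply Rmax_lub.
  - eapply Rle_trans; [now apply IH|]. lra.
  - apply bell_le with 1; auto; [lra|apply Tn_F01; now apply V_F01|]. intros a.
    pose proof (fexp_le_plus X (q x a) (Nat.iter m Top (V theta)) (V (sh theta))
      (INR m * al + al) (Hq x a Hx)) as H.
    rewrite Rmult_0_l, Rplus_0_l. eapply Rle_trans; [apply H|].
    + intros z Hz. eapply Rle_trans; [now apply IH|].
      pose proof (V_diff theta (sh theta) al z Hth Hsh Hz) as Hd.
      enough (V theta z <= V (sh theta) z + al) by lra. apply Hd. intros n.
      eapply Rle_trans; [|apply (Himp n)]. right. apply sumK_ext. intros k _.
      apply Rabs_minus_sym.
    + pose proof (V_step theta x a Hth Hx).
      pose proof (Rmult_le_pos _ _ (proj1 Hth 0%nat) (proj1 (Hg x a Hx))). lra.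
Qed.

(** The finitely many test functions on which [u] and its successor must nearly agree for an
    [n]-fold replay; they determine the weak-* neighbourhood to request from [RR]. *)
Fixpoint continuations (theta : nat -> R) (n : nat) : list (pt -> R) :=
  match n with O => [] | S m => Vn (sh theta) m :: continuations (sh theta) m end.

(** After one play of [s], the new law enters only through its integral against a continuation
    value, so it can be reset to [u] at cost [d]. *)
Lemma Vn_near_invariant u s d theta n : (forall n, 0 <= theta n) -> is_fdist X u -> selection s ->
  Forall (fun h => fexp u h - d <= fexp (fnext q u s) h) (continuations theta n) ->
  sumK n theta * fpay g u s - INR n * d <= fexp u (Vn theta n).
Proof.
  intros H Hu Hs. revert theta H. induction n as [|n IH]; intros theta H Hc.
  - simpl. rewrite fexp_const. lra.
  - inversion_clear Hc as [|? ? H1 H2].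
    assert (H' : forall n, 0 <= sh theta n) by (intros k; apply H).
    specialize (IH (sh theta) H' H2).
    pose proof (bell_selection _ _ _ (H 0%nat) (Vn_bnd (sh theta) n H') u s Hu Hs).
    rewrite sumK_first, S_INR. simpl. change (fun k => theta (S k)) with (sh theta). lra.
Qed.

Lemma Vn_continuous theta n : subeval theta -> cont_on K X (Vn theta n).
Proof.
  intros Hth. apply hlip_cont. intros x y a b Hx Hy Ha Hb.
  eapply Rle_trans; [now apply Vn_hlip; [apply Hth| | | |]|].
  apply Rmult_le_compat_r; [apply norm1_nonneg|apply Hth].
Qed.

(* Near an invariant couple the selection [s] can be replayed [n] times, each repetition
   losing only the (arbitrarily small) distance between [u0] and its successor. *)
Lemma V_ge_RR theta u y : subeval theta -> full_mass theta -> RR K X q g u y -> y <= u (V theta).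
Proof.
  intros Hth Hfull [Hu [Hy HRR]].
  assert (Hn : forall n, sumK n theta * y <= u (V theta)).
  { intros n. apply Rle_trans with (u (Vn theta n)).
    2:{ apply prob_le with K X; auto using Vn_continuous.
        - apply hlip_cont. now apply V_hlip.
        - intros x Hx. now apply Vn_le_V. }
    apply Rnot_lt_le. intros Hlt.
    set (e := sumK n theta * y - u (Vn theta n)).
    assert (He : 0 < e) by (unfold e; lra).
    pose proof (pos_INR n) as Hpn.
    (* Each of the [n] repetitions costs [2 * d], since [u0] and its successor are both [d]-close to
       [u]; the payoff and the integral of [Vn theta n] cost [d] each. The total
       [(2 * INR n + 2) * d] is less than [e]. *)
    set (d := e / (2 * INR n + 3)).
    assert (Hd : 0 < d) by (apply Rdiv_lt_0_compat; lra).
    assert (Hc : forall th, subeval th -> Forall (cont_on K X) (continuations th n)).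
    { clear - HX HA Hq Hg Hqf Hgl. induction n as [|n IH]; intros th Hth; simpl; constructor.
      - apply Vn_continuous. now apply subeval_sh.
      - apply IH. now apply subeval_sh. }
    destruct (HRR (Vn theta n :: continuations theta n) d) as
      [u0 [y0 [s [Hu0 [_ [Hs [N1 [_ [N2 Hpay]]]]]]]]]; [|auto|].
    { constructor; [now apply Vn_continuous|auto]. }
    unfold near, emb in N1, N2. inversion_clear N1 as [|? ? N1a N1b].
    inversion_clear N2 as [|? ? _ N2b].
    assert (Hinv : Forall (fun h => fexp u0 h - 2 * d <= fexp (fnext q u0 s) h)
      (continuations theta n)).
    { rewrite Forall_forall in *. intros h Hh.
      specialize (N1b h Hh). specialize (N2b h Hh). apply Rabs_def2 in N1b, N2b. lra. }
    pose proof (Vn_near_invariant u0 s (2 * d) theta n (proj1 Hth) Hu0 Hs Hinv) as H.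
    apply Rabs_def2 in N1a, Hpay. pose proof (proj2 Hth n) as Hs1.
    pose proof (sumK_nonneg n theta ltac:(intros; apply Hth)) as Hs0.
    assert (Hpay' : sumK n theta * (y - d) <= sumK n theta * fpay g u0 s)
      by (apply Rmult_le_compat_l; lra).
    assert (Hed : (2 * INR n + 3) * d = e) by (unfold d; field; lra).
    assert (sumK n theta * d <= 1 * d) by (apply Rmult_le_compat_r; lra).
    assert (Ee : e = sumK n theta * y - u (Vn theta n)) by reflexivity.
    clearbody d e. lra. }
  apply Rnot_lt_le. intros Hlt.
  destruct (Hfull ((y - u (V theta)) / 2)) as [n Hnm]; [lra|].
  specialize (Hn n).
  assert ((1 - (y - u (V theta)) / 2) * y <= sumK n theta * y) by (apply Rmult_le_compat_r; lra).
  nra.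
Qed.

(** Integration of a continuous function is affine and weak-* continuous. [V theta] itself dominates
    [RR] but is only approximately excessive; its envelope [W (V theta)] satisfies (1) exactly and,
    being larger, keeps (2). *)
Lemma W_admissible theta : subeval theta -> full_mass theta ->
  admissible K X q g (fun u => u (W (V theta))).
Proof.
  intros Hth Hfull. pose proof (V_F01 theta Hth) as HV.
  pose proof (W_F01 _ HV) as [HWl HWb]. pose proof (hlip_cont K X _ HWl) as HWc.
  repeat split.
  - rewrite <- (prob_const K X u 0) by auto. apply prob_le with K X; auto using cont_on_const.
    apply HWb.
  - rewrite <- (prob_const K X u 1) by auto. apply prob_le with K X; auto using cont_on_const.
    apply HWb.
  - intros u Hu e He. exists [W (V theta)], e. split; [now repeat constructor|].
    split; [auto|]. intros u' _ Hn. now inversion_clear Hn.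
  - intros x a Hx. apply Rle_ge. unfold dirac, emb. now apply W_excessive.
  - intros u y HRR. apply Rle_ge. apply Rle_trans with (u (V theta)); [now apply V_ge_RR|].
    apply prob_le with K X; [apply HRR| |auto|].
    + apply hlip_cont. apply HV.
    + intros x Hx. apply (Tn_le_W (V theta) 0 x HV Hx).
Qed.

Context (vs : pt -> R) (Hvs : forall x, X x -> is_glb (vstar_set K X q g x) (vs x)).

Lemma value_lower_bound e : 0 < e -> exists al, 0 < al /\
  forall theta, subeval theta -> full_mass theta -> impatience_le theta al ->
  forall x, X x -> vs x - e <= V theta x.
Proof.
  intros He. destruct (W_uniform (e / 2)) as [M HM]; [lra|].
  pose proof (pos_INR M).
  (* [M] was fixed before [theta], so [M] moves cost at most [e / 2] in impatience, uniformly in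
     [theta]. *)
  exists (e / 2 / (INR M + 1)). split; [apply Rdiv_lt_0_compat; lra|].
  intros theta Hth Hfull Himp x Hx.
  assert (Hvw : vs x <= W (V theta) x).
  { apply (Hvs x Hx). exists (fun u => u (W (V theta))). split; [now apply W_admissible|reflexivity]. }
  pose proof (HM (V theta) x (V_F01 theta Hth) Hx).
  pose proof (V_ge_Tn theta _ M x Hth Himp Hx).
  assert (INR M * (e / 2 / (INR M + 1)) <= (INR M + 1) * (e / 2 / (INR M + 1))).
  { apply Rmult_le_compat_r; [|lra]. apply Rlt_le, Rdiv_lt_0_compat; lra. }
  assert ((INR M + 1) * (e / 2 / (INR M + 1)) = e / 2) by (field; lra). lra.
Qed.

(** * A strategy that is good for a convex family of evaluations *)

Fixpoint law (x : pt) (s : nat -> pt -> list (A * R)) (n : nat) : list (pt * R) :=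
  match n with O => [(x, 1)] | S m => fnext q (law x s m) (s m) end.

Lemma fdist_law x s n : X x -> (forall t, selection (s t)) -> is_fdist X (law x s n).
Proof.
  intros Hx Hs. induction n as [|n IH]; [now apply fdist_dirac|]. now apply fdist_fnext.
Qed.

Lemma fpay_bounds u s : is_fdist X u -> selection s -> 0 <= fpay g u s <= 1.
Proof.
  intros Hu Hs. unfold fpay. split.
  - apply fexp_ge_const with X; auto. intros x Hx.
    apply fexp_ge_const with (fun _ => True); auto. intros a _. now apply Hg.
  - apply fexp_le_const with X; auto. intros x Hx.
    apply fexp_le_const with (fun _ => True); auto. intros a _. now apply Hg.
Qed.

Definition convex_family (Th : (nat -> R) -> Prop) : Prop :=
  (forall theta, Th theta -> subeval theta) /\
  forall theta theta' l, Th theta -> Th theta' -> 0 <= l <= 1 ->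
    Th (fun t => l * theta t + (1 - l) * theta' t).

Lemma shn_mix m theta theta' l :
  shn m (fun t => l * theta t + (1 - l) * theta' t) =
  (fun t => l * shn m theta t + (1 - l) * shn m theta' t).
Proof. extensionality t. now rewrite !shn_eq. Qed.

Lemma V_selection_shn theta t u s : subeval theta -> is_fdist X u -> selection s ->
  theta t * fpay g u s + fexp (fnext q u s) (V (shn (S t) theta)) <= fexp u (V (shn t theta)).
Proof.
  intros Hth Hu Hs. pose proof (V_selection (shn t theta) u s (subeval_shn t theta Hth) Hu Hs) as H.
  rewrite shn_eq, Nat.add_0_r in H. exact H.
Qed.

(** One-stage game: the opponent chooses [theta] in [Th], the player a selection; the payoff is what
    has been earned, plus the present stage, plus the optimal continuation. It is convex in [theta]
    by [V_convex] and affine in the selection. Against a known [theta] a one-step optimal selection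
    preserves the guarantee [c], and minimax makes the selection independent of [theta]. *)
Lemma simultaneous_step Th t u past c d :
  convex_family Th -> is_fdist X u ->
  (forall theta theta' l, past (fun t => l * theta t + (1 - l) * theta' t) =
     l * past theta + (1 - l) * past theta') ->
  (forall theta, Th theta -> 0 <= past theta <= 1) ->
  (forall theta, Th theta -> c <= past theta + fexp u (V (shn t theta))) -> 0 < d ->
  exists s, selection s /\ forall theta, Th theta ->
    c - d <= past theta + (theta t * fpay g u s + fexp (fnext q u s) (V (shn (S t) theta))).
Proof.
  intros [Hsub Hcv] Hu Haff Hpast Hc Hd.
  apply (minimax Th selection (fun theta s =>
    past theta + (theta t * fpay g u s + fexp (fnext q u s) (V (shn (S t) theta)))) 2 c); auto.
  - intros theta s Hth Hs. pose proof (Hsub theta Hth) as Hsth. specialize (Hpast theta Hth).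
    pose proof (V_selection_shn theta t u s Hsth Hu Hs) as H1.
    pose proof (fexp_le_const X u _ 1 Hu (fun x Hx =>
      proj2 (V_bnd1 _ (subeval_shn t theta Hsth) x Hx))) as H2.
    pose proof (fexp_ge_const X (fnext q u s) _ 0 (fdist_fnext u s Hu Hs) (fun x Hx =>
      proj1 (V_bnd1 _ (subeval_shn (S t) theta Hsth) x Hx))) as H3.
    pose proof (Rmult_le_pos _ _ (proj1 Hsth t) (proj1 (fpay_bounds u s Hu Hs))).
    rewrite Rabs_pos_eq; lra.
  - intros theta theta' l Hth Hth' Hl. exists (fun t => l * theta t + (1 - l) * theta' t).
    split; [auto|]. intros s Hs. rewrite Haff, shn_mix.
    assert (H : fexp (fnext q u s) (V (fun k => l * shn (S t) theta k + (1 - l) * shn (S t) theta' k))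
      <= l * fexp (fnext q u s) (V (shn (S t) theta)) +
         (1 - l) * fexp (fnext q u s) (V (shn (S t) theta'))).
    { rewrite <- fexp_lin. apply fexp_le with X; [now apply fdist_fnext|].
      intros x Hx. apply V_convex; auto using subeval_shn.
      rewrite <- shn_mix. apply subeval_shn. auto. }
    lra.
  - intros s s' l Hs Hs' Hl. exists (fun x => mix l (s x) (s' x)). split.
    { intros x Hx. apply fdist_mix; auto. }
    intros theta Hth. rewrite !fexp_fnext. unfold fpay.
    rewrite (fexp_ext X u (fun x => fexp (mix l (s x) (s' x)) (g x))
      (fun x => l * fexp (s x) (g x) + (1 - l) * fexp (s' x) (g x))) by
      (try apply Hu; intros; apply fexp_mix).
    rewrite (fexp_ext X u (fun x => fexp (mix l (s x) (s' x)) (fun a => fexp (q x a) _))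
      (fun x => l * fexp (s x) (fun a => fexp (q x a) (V (shn (S t) theta))) +
        (1 - l) * fexp (s' x) (fun a => fexp (q x a) (V (shn (S t) theta))))) by
      (try apply Hu; intros; apply fexp_mix).
    rewrite !fexp_lin. lra.
  (* Only finitely many numbers in [[0, 1]] matter: [past theta], [theta t], and the continuation
     value at the points of a net of [X]. They cost [d'], [d'] and [3 * d'], the last one including
     two Lipschitz displacements. *)
  - intros e He. set (d' := e / 5). assert (Hd' : 0 < d') by (unfold d'; lra).
    destruct (simplex_net K X d' HX Hd') as [Lx [HLx Hnx]]. rewrite Forall_forall in HLx.
    destruct (finite_net (past :: (fun theta => theta t) ::
      map (fun z theta => V (shn (S t) theta) z) Lx) d' Hd' Th) as [L [HL Hn]].
    { intros theta ev Hth [<-|[<-|Hev]]; [auto| |].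
      - destruct (Hsub theta Hth) as [H0 H1]. split; [auto|].
        specialize (H1 (S t)). simpl in H1.
        pose proof (sumK_nonneg t theta ltac:(auto)). lra.
      - apply in_map_iff in Hev. destruct Hev as [z [<- Hz]].
        apply V_bnd1; auto using subeval_shn. }
    exists L. split; [auto|]. intros theta Hth. destruct (Hn theta Hth) as [theta' [Hin Hcl]].
    exists theta'. split; [auto|]. intros s Hs.
    assert (Hth' : Th theta') by (rewrite Forall_forall in HL; auto).
    pose proof (Rabs_bound _ _ (Hcl _ (or_introl eq_refl))) as H1.
    pose proof (Rabs_bound _ _ (Hcl _ (or_intror (or_introl eq_refl)))) as H2. simpl in H2.
    pose proof (fpay_bounds u s Hu Hs) as Hp.
    assert (H3 : fexp (fnext q u s) (V (shn (S t) theta')) <=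
      fexp (fnext q u s) (V (shn (S t) theta)) + 3 * d').
    { apply fexp_le_plus with X; [now apply fdist_fnext|]. intros x Hx.
      destruct (Hnx x Hx) as [z [Hz [Hxz Hzx]]]. pose proof (HLx z Hz) as Xz.
      pose proof (Rabs_bound _ _ (Hcl (fun theta => V (shn (S t) theta) z)
        (or_intror (or_intror (in_map (fun z theta => V (shn (S t) theta) z) _ _ Hz))))) as H3.
      pose proof (hlip_lip K X _ x z (V_hlip _ (subeval_shn (S t) _ (Hsub _ Hth'))) Hx Xz).
      pose proof (hlip_lip K X _ z x (V_hlip _ (subeval_shn (S t) _ (Hsub _ Hth))) Xz Hx).
      lra. }
    assert ((theta' t - theta t) * fpay g u s <= d' * 1).
    { apply Rle_trans with (d' * fpay g u s);
        [apply Rmult_le_compat_r|apply Rmult_le_compat_l]; lra. }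
    assert (5 * d' = e) by (unfold d'; field). lra.
  - intros theta e Hth He. pose proof (subeval_shn t theta (Hsub theta Hth)) as Hst.
    destruct (choice (fun x a => X x -> V (shn t theta) x - e <=
      theta t * g x a + fexp (q x a) (V (shn (S t) theta)))) as [sel Hsel].
    { intros x. destruct (classic (X x)) as [Hx|Hx].
      - destruct (V_approx (shn t theta) x e Hst Hx He) as [a Ha]. exists a. intros _.
        rewrite shn_eq, Nat.add_0_r in Ha. exact Ha.
      - destruct HA as [a]. exists a. tauto. }
    exists (fun x => [(sel x, 1)]). split; [intros x Hx; now apply fdist_dirac|].
    specialize (Hc theta Hth).
    assert (H : fexp u (V (shn t theta)) <= theta t * fpay g u (fun x => [(sel x, 1)]) +
      1 * fexp (fnext q u (fun x => [(sel x, 1)])) (V (shn (S t) theta)) + e).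
    { unfold fpay. rewrite fexp_fnext, <- fexp_lin. apply fexp_le_plus with X; [auto|].
      intros x Hx. specialize (Hsel x Hx). simpl in *. lra. }
    lra.
  - destruct HA as [a]. exists (fun _ => [(a, 1)]). intros x Hx. now apply fdist_dirac.
Qed.

Lemma simultaneous_selections Th x c d :
  convex_family Th -> X x -> (forall theta, Th theta -> c <= V theta x) -> 0 < d ->
  exists s, (forall t, selection (s t)) /\ forall t theta, Th theta ->
    c - d <= sumK t (fun k => theta k * fpay g (law x s k) (s k))
      + fexp (law x s t) (V (shn t theta)).
Proof.
  intros HTh Hx Hc Hd.
  (* Stage [t] may lose [d / 2^(t+1)]; [err t] is the loss accumulated before it, always below
     [d]. *)
  set (err := fun t : nat => d * (1 - (/ 2) ^ t)).
  assert (Herr : forall t, 0 < err (S t) - err t).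
  { intros t. unfold err. simpl. assert (0 < (/ 2) ^ t) by (apply pow_lt; lra).
    pose proof (Rmult_lt_0_compat _ _ Hd H). lra. }
  set (good := fun t (st : list (pt * R) * ((nat -> R) -> R)) s => selection s /\
    forall theta, Th theta -> c - err (S t) <=
      snd st theta + (theta t * fpay g (fst st) s + fexp (fnext q (fst st) s) (V (shn (S t) theta)))).
  set (sel := fun t st => epsilon (inhabits (fun _ : pt => @nil (A * R))) (good t st)).
  (* The state holds the current law and the payoff earned so far. The latter is kept as a
     functional of [theta], since each selection has to answer all evaluations at once. *)
  set (st := fix st (t : nat) : list (pt * R) * ((nat -> R) -> R) :=
    match t with
    | O => ([(x, 1)], fun _ => 0)
    | S k => (fnext q (fst (st k)) (sel k (st k)),
        fun theta => snd (st k) theta + theta k * fpay g (fst (st k)) (sel k (st k)))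
    end).
  assert (Hinv : forall t, is_fdist X (fst (st t)) /\
    (forall theta theta' l, snd (st t) (fun t => l * theta t + (1 - l) * theta' t) =
       l * snd (st t) theta + (1 - l) * snd (st t) theta') /\
    (forall theta, Th theta -> 0 <= snd (st t) theta <= sumK t theta) /\
    (forall theta, Th theta ->
      c - err t <= snd (st t) theta + fexp (fst (st t)) (V (shn t theta))) ->
    good t (st t) (sel t (st t))).
  { intros t [H1 [H2 [H3 H4]]]. apply epsilon_spec.
    destruct (simultaneous_step Th t (fst (st t)) (snd (st t)) (c - err t) (err (S t) - err t))
      as [s [Hs Hgood]]; auto.
    - intros theta Hth. specialize (H3 theta Hth). pose proof (proj2 (proj1 HTh theta Hth) t). lra.
    - exists s. split; [auto|]. intros theta Hth. specialize (Hgood theta Hth). lra. }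
  assert (Hall : forall t, is_fdist X (fst (st t)) /\
    (forall theta theta' l, snd (st t) (fun t => l * theta t + (1 - l) * theta' t) =
       l * snd (st t) theta + (1 - l) * snd (st t) theta') /\
    (forall theta, Th theta -> 0 <= snd (st t) theta <= sumK t theta) /\
    (forall theta, Th theta ->
      c - err t <= snd (st t) theta + fexp (fst (st t)) (V (shn t theta)))).
  { induction t as [|t IH].
    - simpl. repeat split.
      + repeat constructor; simpl; auto; lra.
      + simpl. lra.
      + intros. ring.
      + lra.
      + lra.
      + intros theta Hth. specialize (Hc theta Hth). unfold err. simpl. lra.
    - pose proof (Hinv t IH) as [Hs Hg']. destruct IH as [H1 [H2 [H3 _]]].
      split; [now apply fdist_fnext|]. split; [|split].
      + intros theta theta' l. simpl. rewrite H2. ring.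
      + intros theta Hth. specialize (H3 theta Hth). simpl.
        pose proof (fpay_bounds _ _ H1 Hs). pose proof (proj1 (proj1 HTh theta Hth) t). nra.
      + intros theta Hth. specialize (Hg' theta Hth). simpl in *. lra. }
  exists (fun t => sel t (st t)).
  assert (Hlaw : forall t, law x (fun t => sel t (st t)) t = fst (st t)).
  { induction t as [|t IH]; simpl; [reflexivity|]. now rewrite IH. }
  assert (Hpast : forall t theta, sumK t (fun k => theta k *
    fpay g (law x (fun t => sel t (st t)) k) (sel k (st k))) = snd (st t) theta).
  { induction t as [|t IH]; intros theta; [reflexivity|].
    change (sumK t (fun k => theta k * fpay g (law x (fun t => sel t (st t)) k) (sel k (st k)))
      + theta t * fpay g (law x (fun t => sel t (st t)) t) (sel t (st t)) = snd (st (S t)) theta).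
    now rewrite IH, Hlaw. }
  split.
  - intros t. apply (Hinv t (Hall t)).
  - intros t theta Hth. rewrite Hpast, Hlaw.
    pose proof (proj2 (proj2 (proj2 (Hall t))) theta Hth).
    assert (err t <= d); [|lra]. unfold err. assert (0 < (/ 2) ^ t) by (apply pow_lt; lra). nra.
Qed.

(** * Behavior strategies *)

Lemma fexp_stage_dist sg x n F :
  fexp (stage_dist q sg x (S n)) F = fexp (stage_dist q sg x n) (fun hx =>
    fexp (sg (fst hx) (snd hx)) (fun a => fexp (q (snd hx) a) (fun y => F (fst hx ++ [(snd hx, a)], y)))).
Proof.
  simpl. apply fexp_flat_map. intros [[h z] p]. simpl. rewrite <- fexp_scal.
  apply fexp_flat_map. intros [a r]. simpl.
  rewrite (fexp_map _ (fun y => (h ++ [(z, a)], y))). ring.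
Qed.

(** The length is recorded because [markov] reads the stage number off the history. *)
Definition reach (n : nat) (hx : hist A * pt) : Prop := X (snd hx) /\ length (fst hx) = n.

Lemma stage_dist_fdist sg x n : X x -> valid_strategy sg ->
  is_fdist (reach n) (stage_dist q sg x n).
Proof.
  intros Hx Hsg. induction n as [|n IH]; [now apply fdist_dirac|]. split.
  - simpl. apply (Forall_flat_map_weight (reach n) (reach (S n)) _ _ (proj1 IH)).
    intros [[h z] p] [Hz Hh] Hp. simpl in *.
    apply (Forall_flat_map_weight (fun _ => True) (reach (S n)) _ _ (proj1 (Hsg h z))).
    intros [a r] _ Hr. simpl in *.
    apply (Forall_map_weight X (reach (S n)) (q z a) (fun y => (h ++ [(z, a)], y))).
    + now apply Rmult_le_pos.
    + apply Hq; auto.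
    + intros y Hy. unfold reach. simpl. rewrite length_app. simpl. split; [auto|lia].
  - rewrite total_fexp, fexp_stage_dist. destruct IH as [Hf Ht].
    transitivity (fexp (stage_dist q sg x n) (fun _ => 1)); [|now rewrite <- total_fexp].
    apply fexp_ext with (reach n); [exact Hf|]. intros [h z] [Hz _]. simpl in *.
    transitivity (fexp (sg h z) (fun _ => 1)).
    + apply fexp_ext with (fun _ => True); [apply (Hsg h z)|]. intros a _. rewrite <- total_fexp. apply Hq; auto.
    + rewrite <- total_fexp. apply Hsg.
Qed.

Lemma stage_payoff_bounds sg x n : X x -> valid_strategy sg -> 0 <= stage_payoff q g sg x n <= 1.
Proof.
  intros Hx Hsg. pose proof (stage_dist_fdist sg x n Hx Hsg) as Hd. unfold stage_payoff. split.
  - apply fexp_ge_const with (reach n); [exact Hd|]. intros [h z] [Hz _].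
    apply fexp_ge_const with (fun _ => True); [apply Hsg|]. intros a _. now apply Hg.
  - apply fexp_le_const with (reach n); [exact Hd|]. intros [h z] [Hz _].
    apply fexp_le_const with (fun _ => True); [apply Hsg|]. intros a _. now apply Hg.
Qed.

(** Past payoff plus expected continuation value is a supermartingale under any behavior strategy:
    by [V_step] it cannot increase with [m], and it starts at [V theta x]. *)
Lemma strategy_le_V sg theta x : X x -> valid_strategy sg -> subeval theta -> forall m,
  sumK m (fun t => theta t * stage_payoff q g sg x t)
    + fexp (stage_dist q sg x m) (fun hx => V (shn m theta) (snd hx)) <= V theta x.
Proof.
  intros Hx Hsg Hth. induction m as [|m IH]; [simpl; lra|].
  eapply Rle_trans; [|exact IH]. clear IH. simpl sumK. rewrite Rplus_assoc.
  apply Rplus_le_compat_l. unfold stage_payoff. rewrite fexp_stage_dist, <- fexp_scal.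
  rewrite <- (Rmult_1_l (fexp _ (fun x0 => theta m * _))), <- (Rmult_1_l (fexp _ (fun hx => fexp _ _))).
  rewrite <- fexp_lin.
  apply fexp_le with (reach m); [apply (stage_dist_fdist sg x m Hx Hsg)|]. intros [h z] [Hz _]. cbn [fst snd].
  rewrite !Rmult_1_l, <- (Rmult_1_l (fexp _ (fun a => fexp (q z a) _))), <- fexp_lin.
  apply fexp_le_const with (fun _ => True); [apply Hsg|]. intros a _.
  pose proof (V_step (shn m theta) z a (subeval_shn m theta Hth) Hz) as H.
  rewrite shn_eq, Nat.add_0_r in H. rewrite Rmult_1_l. exact H.
Qed.

(* Outside [X] the selections are unconstrained, whereas a strategy must be defined there. *)
Definition markov (a0 : A) (s : nat -> pt -> list (A * R)) : strategy A :=
  fun h x => if excluded_middle_informative (X x) then s (length h) x else [(a0, 1)].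

Lemma markov_valid a0 s : (forall t, selection (s t)) -> valid_strategy (markov a0 s).
Proof.
  intros Hs h x. unfold markov. destruct (excluded_middle_informative (X x)) as [Hx|_].
  - now apply Hs.
  - now apply fdist_dirac.
Qed.

Lemma stage_dist_markov a0 s x n f : X x -> (forall t, selection (s t)) ->
  fexp (stage_dist q (markov a0 s) x n) (fun hx => f (snd hx)) = fexp (law x s n) f.
Proof.
  intros Hx Hs. revert f. induction n as [|n IH]; intros f; [reflexivity|].
  rewrite fexp_stage_dist. simpl law. rewrite fexp_fnext, <- IH.
  apply fexp_ext with (reach n); [apply (stage_dist_fdist _ x n Hx (markov_valid a0 s Hs))|].
  intros [h z] [Hz Hh]. simpl in *. unfold markov.
  destruct (excluded_middle_informative (X z)); [now rewrite Hh|tauto].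
Qed.

Lemma stage_payoff_markov a0 s x n : X x -> (forall t, selection (s t)) ->
  stage_payoff q g (markov a0 s) x n = fpay g (law x s n) (s n).
Proof.
  intros Hx Hs. unfold stage_payoff, fpay.
  rewrite <- (stage_dist_markov a0 s x n (fun z => fexp (s n z) (g z))) by auto.
  apply fexp_ext with (reach n); [apply (stage_dist_fdist _ x n Hx (markov_valid a0 s Hs))|].
  intros [h z] [Hz Hh]. simpl in *. unfold markov.
  destruct (excluded_middle_informative (X z)); [now rewrite Hh|tauto].
Qed.

(** * Occupation measures and the upper bound *)

(* The selection at [x] averages the mixed actions of all entries located at [x], with their
   relative weights. *)
Lemma aggregate (l : list ((pt * list (A * R)) * R)) :
  Forall (fun p => (X (fst (fst p)) /\ is_fdist (fun _ : A => True) (snd (fst p)))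
    /\ 0 <= snd p) l ->
  exists u s, Forall (fun p => X (fst p) /\ 0 <= snd p) u /\ selection s /\
    (forall h, fexp u h = fexp l (fun p => h (fst p))) /\
    (forall phi, fexp u (fun x => fexp (s x) (phi x)) = fexp l (fun p => fexp (snd p) (phi (fst p)))).
Proof.
  intros Hl. induction Hl as [|[[x sg] p] l [[Hx Hsg] Hp] _ [u [s [Hu [Hs [Eh Ephi]]]]]].
  - destruct HA as [a]. exists [], (fun _ => [(a, 1)]).
    split; [constructor|]. split; [intros x _; now apply fdist_dirac|]. now split.
  - simpl in Hx, Hsg, Hp. set (ind := fun y => if excluded_middle_informative (y = x) then 1 else 0).
    set (P := fexp u ind).
    assert (HP : 0 <= P).
    { apply fexp_nonneg with X; [auto|]. intros y _. unfold ind.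
      destruct (excluded_middle_informative (y = x)); lra. }
    (* With no mass at [x] relative weights make no sense; the new entry then has weight 0 and the
       selection is left unchanged. *)
    destruct (Req_dec (p + P) 0) as [E0|Hne].
    + exists ((x, p) :: u), s. split; [constructor; auto|]. split; [auto|].
      assert (p = 0) by lra. split.
      * intros h. simpl. now rewrite Eh.
      * intros phi. simpl. rewrite Ephi. subst p. ring.
    + set (r := p / (p + P)).
      assert (Hr : 0 <= r <= 1).
      { unfold r. split; [apply Rle_mult_inv_pos; lra|].
        apply Rmult_le_reg_r with (p + P); [lra|]. unfold Rdiv. rewrite Rmult_assoc, Rinv_l; lra. }
      exists ((x, p) :: u), (fun y => if excluded_middle_informative (y = x)
        then mix r sg (s x) else s y).
      split; [constructor; auto|]. split; [|split].
      * intros y Hy. destruct (excluded_middle_informative (y = x)); [|auto].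
        apply fdist_mix; auto.
      * intros h. simpl. now rewrite Eh.
      * intros phi. simpl. rewrite <- Ephi.
        set (c := fexp (mix r sg (s x)) (phi x)).
        rewrite (fexp_ext X u _ (fun y => 1 * fexp (s y) (phi y) +
          (c - fexp (s x) (phi x)) * ind y)); [|exact Hu|].
        -- rewrite fexp_lin. fold P.
           destruct (excluded_middle_informative (x = x)); [|tauto].
           fold c. assert (Ec : (p + P) * c = p * fexp sg (phi x) + P * fexp (s x) (phi x)).
           { unfold c, r. rewrite fexp_mix. field. lra. }
           lra.
        -- intros y _. unfold ind. destruct (excluded_middle_informative (y = x)) as [->|_].
           ++ fold c. ring.
           ++ ring.
Qed.

(** Each state is stored with the mixed action used there, because the same state may be visited at
    several stages with different actions; [aggregate] then extracts one stationary selection. *)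
Fixpoint occupation_list (theta : nat -> R) (x : pt) (s : nat -> pt -> list (A * R)) (n : nat)
  : list ((pt * list (A * R)) * R) :=
  match n with
  | O => []
  | S m => map (fun e => ((fst e, s m (fst e)), theta m * snd e)) (law x s m)
           ++ occupation_list theta x s m
  end.

Lemma fexp_occupation theta x s n Psi :
  fexp (occupation_list theta x s n) Psi =
  sumK n (fun t => theta t * fexp (law x s t) (fun z => Psi (z, s t z))).
Proof.
  induction n as [|n IH]; simpl; [reflexivity|].
  rewrite fexp_app, IH, (fexp_map _ (fun z => (z, s n z))). ring.
Qed.

Lemma occupation_Forall theta x s n : (forall t, 0 <= theta t) -> X x ->
  (forall t, selection (s t)) ->
  Forall (fun p => (X (fst (fst p)) /\ is_fdist (fun _ : A => True) (snd (fst p)))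
    /\ 0 <= snd p) (occupation_list theta x s n).
Proof.
  intros Hth Hx Hs. induction n as [|n IH]; simpl; [constructor|].
  apply Forall_app. split; [|auto].
  apply (Forall_map_weight X (fun p => X (fst p) /\ is_fdist (fun _ : A => True) (snd p)) _
    (fun z => (z, s n z))); [auto|now apply fdist_law|].
  intros z Hz. simpl. split; [auto|]. now apply Hs.
Qed.

Lemma fexp_law_excessive x s f n : X x -> (forall t, selection (s t)) ->
  (forall z a, X z -> fexp (q z a) f <= f z) -> fexp (law x s n) f <= f x.
Proof.
  intros Hx Hs Hf. induction n as [|n IH]; [simpl; lra|].
  eapply Rle_trans; [|exact IH]. simpl. rewrite fexp_fnext.
  apply fexp_le with X; [now apply fdist_law|]. intros z Hz.
  apply fexp_le_const with (fun _ => True); [now apply Hs|]. auto.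
Qed.

(** If [theta t] exceeded [al], the later weights, which vary by at most [al] in total, would all
    stay above the positive number [theta t - al], contradicting the finite mass. *)
Lemma impatience_weight theta al t : subeval theta -> impatience_le theta al -> theta t <= al.
Proof.
  intros [H0 H1] Himp. apply Rnot_lt_le. intros Hlt.
  assert (Hstay : forall n, theta t - al <= theta (t + n)%nat).
  { intros n. pose proof (Himp (t + n)%nat) as H. rewrite sumK_add in H.
    pose proof (sumK_nonneg t (fun k => Rabs (theta (S k) - theta k)) ltac:(intros; apply Rabs_pos)).
    assert (Ht : theta t - theta (t + n)%nat <=
      sumK n (fun k => Rabs (theta (S (t + k)) - theta (t + k)%nat))).
    { clear. induction n as [|n IH]; simpl; [rewrite Nat.add_0_r; lra|].
      rewrite Nat.add_succ_r. rewrite Rabs_minus_sym.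
      pose proof (Rle_abs (theta (t + n)%nat - theta (S (t + n)))). lra. }
    lra. }
  destruct (INR_unbounded (1 / (theta t - al))) as [n Hn].
  pose proof (H1 (t + n)%nat) as Hs. rewrite sumK_add in Hs.
  pose proof (sumK_nonneg t theta ltac:(auto)).
  assert (INR n * (theta t - al) <= sumK n (fun k => theta (t + k)%nat)).
  { clear - Hstay. induction n as [|n IH]; [simpl; lra|]. rewrite S_INR. simpl.
    specialize (Hstay n). lra. }
  apply Rmult_gt_compat_r with (r := theta t - al) in Hn; [|lra].
  unfold Rdiv in Hn. rewrite Rmult_assoc, Rinv_l in Hn; lra.
Qed.

(** Abel summation: the two boundary terms are each at most [al * B] by [impatience_weight], and so
    is the sum against the increments of [theta], whence the factor 3. *)
Lemma summation_by_parts theta al a B n : subeval theta -> impatience_le theta al ->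
  (forall t, Rabs (a t) <= B) ->
  Rabs (sumK n (fun t => theta t * (a (S t) - a t))) <= 3 * al * B.
Proof.
  intros Hth Himp Ha. assert (HB : 0 <= B) by (eapply Rle_trans; [apply Rabs_pos|apply (Ha 0%nat)]).
  assert (E : sumK n (fun t => theta t * (a (S t) - a t)) =
    theta n * a n - theta 0%nat * a 0%nat - sumK n (fun t => (theta (S t) - theta t) * a (S t))).
  { induction n as [|n IH]; simpl; [ring|]. rewrite IH. ring. }
  assert (Hend : forall k, Rabs (theta k * a k) <= al * B).
  { intros k. rewrite Rabs_mult, Rabs_pos_eq by apply Hth.
    apply Rmult_le_compat; [apply Hth|apply Rabs_pos|now apply impatience_weight|auto]. }
  assert (Hsum : Rabs (sumK n (fun t => (theta (S t) - theta t) * a (S t))) <= al * B).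
  { apply Rle_trans with (B * sumK n (fun t => Rabs (theta (S t) - theta t))).
    - clear - Ha HB. induction n as [|n IH]; simpl; [rewrite Rabs_R0; lra|].
      eapply Rle_trans; [apply Rabs_triang|]. rewrite Rabs_mult, Rmult_plus_distr_l.
      apply Rplus_le_compat; [auto|]. rewrite Rmult_comm.
      apply Rmult_le_compat_r; [apply Rabs_pos|auto].
    - rewrite Rmult_comm. apply Rmult_le_compat_r; auto. }
  rewrite E. pose proof (Rabs_bound _ _ (Hend n)). pose proof (Rabs_bound _ _ (Hend 0%nat)).
  apply Rabs_bound in Hsum. apply Rabs_le. lra.
Qed.

Lemma V_shn_small theta n e : subeval theta -> 1 - e <= sumK n theta -> bnd e (V (shn n theta)).
Proof.
  intros Hth Hn. apply V_bnd; [now apply subeval_shn|]. intros m.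
  pose proof (proj2 Hth (n + m)%nat) as H. rewrite sumK_add in H.
  rewrite (sumK_ext m (shn n theta) (fun k => theta (n + k)%nat)) by (intros; apply shn_eq). lra.
Qed.

(** The [theta]-weighted occupation measure of a near-optimal play. Its payoff is the value, its
    successor is itself shifted by one stage and hence close by summation by parts, and excessive
    functions decrease in mean along the play. *)
Lemma occupation theta al d x :
  subeval theta -> full_mass theta -> impatience_le theta al -> 0 < d -> X x ->
  exists u s, is_fdist X u /\ selection s /\ V theta x - d <= fpay g u s /\
    (forall h B, (forall z, X z -> Rabs (h z) <= B) ->
       Rabs (fexp (fnext q u s) h - fexp u h) <= (3 * al + d) * B) /\
    (forall f, (forall z a, X z -> fexp (q z a) f <= f z) -> fexp u f <= f x).
Proof.
  intros Hth Hfull Himp Hd Hx.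
  (* The family reduced to [theta] alone is convex, so near-optimal selections come from the same
     construction. *)
  destruct (simultaneous_selections (eq theta) x (V theta x) (d / 2)) as [s [Hs HV]]; auto; [|now intros ? <-; lra|lra|].
  { split; [now intros ? <-|]. intros th th' l <- <- _. extensionality t. ring. }
  destruct (Hfull (d / 2)) as [T HT]; [lra|].
  (* Truncation at [T] leaves mass [r] missing, which is put on [x] with the first selection. This
     harms no payoff, and displaces integrals by at most [2 * r * B <= d * B]. *)
  set (r := 1 - sumK T theta).
  assert (Hr : 0 <= r <= d / 2) by (pose proof (proj2 Hth T); unfold r; lra).
  destruct (aggregate (occupation_list (fun _ => r) x s 1 ++ occupation_list theta x s T))
    as [u [s' [Hu [Hs' [Eh Ephi]]]]].
  { apply Forall_app. split; apply occupation_Forall; auto; [intros _; lra|apply Hth]. }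
  assert (Eh' : forall h, fexp u h = r * h x + sumK T (fun t => theta t * fexp (law x s t) h)).
  { intros h. rewrite Eh, fexp_app, !fexp_occupation.
    change (sumK T (fun t => theta t * fexp (law x s t) (fun z => h (fst (z, s t z)))))
      with (sumK T (fun t => theta t * fexp (law x s t) h)).
    simpl. ring. }
  assert (Ephi' : forall phi, fexp u (fun z => fexp (s' z) (phi z)) =
    r * fexp (s 0%nat x) (phi x) +
    sumK T (fun t => theta t * fexp (law x s t) (fun z => fexp (s t z) (phi z)))).
  { intros phi. rewrite Ephi, fexp_app, !fexp_occupation. simpl. ring. }
  exists u, s'. split; [|split; [auto|split; [|split]]].
  - split; [auto|]. rewrite total_fexp, Eh'.
    rewrite (sumK_ext T _ (fun t => 1 * theta t + 0 * theta t)).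
    + rewrite sumK_lin. unfold r. ring.
    + intros t _. rewrite <- total_fexp, (proj2 (fdist_law x s t Hx Hs)). ring.
  - unfold fpay. rewrite Ephi'. specialize (HV T theta eq_refl).
    pose proof (fexp_le_const X _ _ (d / 2) (fdist_law x s T Hx Hs)
      (fun z Hz => proj2 (V_shn_small theta T (d / 2) Hth HT z Hz))) as Hsmall.
    assert (0 <= fexp (s 0%nat x) (g x)).
    { apply fexp_ge_const with (fun _ => True); [now apply Hs|]. intros a _. now apply Hg. }
    pose proof (Rmult_le_pos _ _ (proj1 Hr) H). unfold fpay in HV. lra.
  - intros h B HB. set (a := fun t => fexp (law x s t) h).
    assert (Ha : forall t, Rabs (a t) <= B).
    { intros t. apply Rabs_le. split.
      - apply fexp_ge_const with X; [now apply fdist_law|]. intros z Hz.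
        apply (Rabs_bound _ _ (HB z Hz)).
      - apply fexp_le_const with X; [now apply fdist_law|]. intros z Hz.
        apply (Rabs_bound _ _ (HB z Hz)). }
    rewrite fexp_fnext, (Ephi' (fun z b => fexp (q z b) h)), Eh'.
    assert (E : forall t, a (S t) = fexp (law x s t) (fun z => fexp (s t z) (fun b => fexp (q z b) h)))
      by (intros t; unfold a; simpl; apply fexp_fnext).
    assert (E1 : a 1%nat = fexp (s 0%nat x) (fun b => fexp (q x b) h))
      by (rewrite E; simpl; ring).
    assert (E0 : a 0%nat = h x) by (unfold a; simpl; ring).
    pose proof (summation_by_parts theta al a B T Hth Himp Ha) as Hparts.
    rewrite (sumK_ext T _ (fun t => 1 * (theta t * a (S t)) + (- 1) * (theta t * a t))) in Hparts
      by (intros; ring).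
    rewrite sumK_lin in Hparts.
    rewrite (sumK_ext T (fun t => theta t * a (S t)) (fun t => theta t *
      fexp (law x s t) (fun z => fexp (s t z) (fun b => fexp (q z b) h)))) in Hparts
      by (intros t _; now rewrite E).
    rewrite <- E1, <- E0.
    pose proof (Rabs_bound _ _ (Ha 0%nat)). pose proof (Rabs_bound _ _ (Ha 1%nat)).
    apply Rabs_bound in Hparts. change (fun t => theta t * a t) with
      (fun t => theta t * fexp (law x s t) h) in Hparts.
    assert (r * (a 1%nat - a 0%nat) <= d / 2 * (2 * B)).
    { apply Rle_trans with (r * (2 * B)); [apply Rmult_le_compat_l|apply Rmult_le_compat_r]; lra. }
    assert (r * (a 0%nat - a 1%nat) <= d / 2 * (2 * B)).
    { apply Rle_trans with (r * (2 * B)); [apply Rmult_le_compat_l|apply Rmult_le_compat_r]; lra. }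
    apply Rabs_le. lra.
  - intros f Hf. rewrite Eh'.
    assert (sumK T (fun t => theta t * fexp (law x s t) f) <= sumK T (fun t => f x * theta t + 0 * 0)).
    { apply sumK_le. intros t _. pose proof (fexp_law_excessive x s f t Hx Hs Hf).
      pose proof (Rmult_le_compat_l _ _ _ (proj1 Hth t) H). lra. }
    rewrite (sumK_lin T (f x) theta 0 (fun _ => 0)) in H.
    unfold r. lra.
Qed.

(** [affine_on] only handles mixtures of two probabilities, so the induction on the list must
    renormalise the tail: hence the intermediate claim for arbitrary positive mass [c], and the
    separate case of a tail of mass 0. *)
Lemma affine_emb w u : affine_on K X w -> is_fdist X u ->
  w (emb u) = fexp u (fun x => w (dirac x)).
Proof.
  intros Hw [Hu Ht].
  assert (H : forall c, 0 < c -> total u = c ->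
    w (emb (map (fun e => (fst e, / c * snd e)) u)) = / c * fexp u (fun x => w (dirac x))).
  { clear Ht. induction Hu as [|[x p] u [Hx Hp] Hu IH]; intros c Hc Ht; simpl in *; [lra|].
    pose proof (total_nonneg X u Hu) as H0.
    destruct (Rle_lt_or_eq_dec _ _ H0) as [Hlt|Heq].
    - specialize (IH (total u) Hlt eq_refl).
      assert (Hcp : / c * p + / c * total u = 1) by (rewrite <- Rmult_plus_distr_l, Ht; field; lra).
      assert (Hic : 0 < / c) by now apply Rinv_0_lt_compat.
      replace (emb ((x, / c * p) :: map (fun e => (fst e, / c * snd e)) u)) with
        (fun h => (/ c * p) * dirac x h +
          (1 - / c * p) * emb (map (fun e => (fst e, / total u * snd e)) u) h).
      + rewrite Hw, IH.
        * replace (1 - / c * p) with (/ c * total u) by lra. field. lra.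
        * replace (dirac x) with (emb [(x, 1)]).
          -- apply prob_emb. now apply fdist_dirac.
          -- extensionality h. unfold emb, dirac. simpl. ring.
        * apply prob_emb. split.
          -- apply (Forall_map_weight X X u (fun y => y)); auto. left. now apply Rinv_0_lt_compat.
          -- rewrite total_fexp, (fexp_map u (fun y => y)), <- total_fexp. field. lra.
        * pose proof (Rmult_le_pos (/ c) p ltac:(lra) Hp).
          pose proof (Rmult_lt_0_compat (/ c) (total u) ltac:(lra) Hlt). lra.
      + extensionality h. unfold emb, dirac. simpl.
        rewrite !(fexp_map u (fun y => y)).
        replace (1 - / c * p) with (/ c * total u) by lra. field. lra.
    - replace (emb ((x, / c * p) :: map (fun e => (fst e, / c * snd e)) u)) with (dirac x).
      + rewrite (fexp_total0 X u) by auto. replace p with c by lra. field. lra.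
      + extensionality h. unfold emb, dirac. simpl. rewrite (fexp_map u (fun y => y)).
        rewrite (fexp_total0 X u) by auto. replace p with c by lra. field. lra. }
  specialize (H 1 ltac:(lra) Ht). rewrite Rinv_1, Rmult_1_l in H. rewrite <- H. f_equal.
  extensionality h. unfold emb. now rewrite (fexp_map u (fun y => y)), Rmult_1_l.
Qed.

(* A limit along an ultrafilter of occupation measures of ever more patient evaluations is an
   invariant couple. *)
Lemma value_upper_bound_at w x e : admissible K X q g w -> X x -> 0 < e ->
  exists al, 0 < al /\ forall theta, subeval theta -> full_mass theta -> impatience_le theta al ->
    V theta x <= w (dirac x) + e.
Proof.
  intros [_ [Haff [Hcont [Hexc HwRR]]]] Hx He. apply NNPP. intros Hno.
  set (al := fun n : nat => / (INR n + 1)).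
  assert (Hal : forall n, 0 < al n).
  { intros n. pose proof (pos_INR n). apply Rinv_0_lt_compat. lra. }
  assert (Hal0 : forall c, 0 < c -> exists N, forall n, (N <= n)%nat -> al n < c).
  { intros c Hc. destruct (INR_unbounded (/ c)) as [N HN]. exists N. intros n Hn.
    apply le_INR in Hn. pose proof (Rinv_0_lt_compat c Hc). unfold al.
    rewrite <- (Rinv_inv c). apply Rinv_0_lt_contravar; lra. }
  set (f := fun z => w (dirac z)).
  assert (Hf : forall z a, X z -> fexp (q z a) f <= f z).
  { intros z a Hz. unfold f. rewrite <- affine_emb by auto. apply Rge_le. now apply Hexc. }
  (* If no threshold works, every [al n] has a counterexample [theta]; its occupation measure, taken
     with precision [al n], is almost invariant and pays more than [f x + e - al n]. *)
  destruct (choice (fun n (us : list (pt * R) * (pt -> list (A * R))) =>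
    is_fdist X (fst us) /\ selection (snd us) /\
    f x + e - al n <= fpay g (fst us) (snd us) /\
    (forall h B, (forall z, X z -> Rabs (h z) <= B) ->
       Rabs (fexp (fnext q (fst us) (snd us)) h - fexp (fst us) h) <= (3 * al n + al n) * B) /\
    fexp (fst us) f <= f x)) as [us Hus].
  { intros n. apply NNPP. intros Hn. apply Hno. exists (al n). split; [auto|].
    intros theta Hth Hfull Himp. apply Rnot_lt_le. intros Hlt. apply Hn.
    destruct (occupation theta (al n) (al n) x Hth Hfull Himp (Hal n) Hx)
      as [u [s [H1 [H2 [H3 [H4 H5]]]]]].
    exists (u, s). simpl. split; [auto|]. split; [auto|]. split; [unfold f; lra|]. split; auto. }
  destruct free_ultrafilter_exists as [U HU].
  pose proof HU as [Uc [Ui [Us _]]].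
  (* The limit functional; its value is junk when the integrals of [h] have no limit, which cannot
     happen for continuous [h]. *)
  set (m := fun h => epsilon (inhabits 0) (is_ulim U (fun n => fexp (fst (us n)) h))).
  assert (Hm : forall h, cont_on K X h -> is_ulim U (fun n => fexp (fst (us n)) h) (m h)).
  { intros h Hh. unfold m. apply epsilon_spec.
    destruct (cont_bounded K X h HXc Hh) as [B [_ HB]].
    apply (ulim_exists U HU _ B). intros n. destruct (Hus n) as [Hfd _]. apply Rabs_le. split.
    - apply fexp_ge_const with X; [auto|]. intros z Hz. apply (Rabs_bound _ _ (HB z Hz)).
    - apply fexp_le_const with X; [auto|]. intros z Hz. apply (Rabs_bound _ _ (HB z Hz)). }
  assert (Hprob : is_prob K X m).
  { repeat split.
    - intros h h' Hh Hh'. eapply ulim_unique; [exact HU|apply Hm; now apply cont_on_plus|].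
      pose proof (ulim_lin U HU _ _ _ _ 1 1 (Hm h Hh) (Hm h' Hh')) as H. rewrite !Rmult_1_l in H.
      intros d Hd. eapply Us; [|apply (H d Hd)]. simpl. intros n Hn.
      rewrite <- fexp_lin in Hn.
      replace (fun z => h z + h' z) with (fun z => 1 * h z + 1 * h' z) by (extensionality z; ring).
      exact Hn.
    - intros c h Hh. eapply ulim_unique; [exact HU|apply Hm; now apply cont_on_scal|].
      pose proof (ulim_lin U HU _ _ _ _ c 0 (Hm h Hh) (Hm h Hh)) as H.
      rewrite Rmult_0_l, Rplus_0_r in H.
      intros d Hd. eapply Us; [|apply (H d Hd)]. simpl. intros n Hn.
      rewrite fexp_scal. rewrite Rmult_0_l, Rplus_0_r in Hn. exact Hn.
    - intros h Hh Hpos. eapply ulim_le; [exact HU|now apply Hm|]. intros n.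
      apply fexp_nonneg with X; [apply Hus|auto].
    - eapply ulim_unique; [exact HU|apply Hm, cont_on_const|].
      intros d Hd. apply Uc with 0%nat. intros n _. rewrite <- total_fexp.
      rewrite (proj2 (proj1 (Hus n))), Rminus_diag, Rabs_R0. auto. }
  destruct (ulim_exists U HU (fun n => fpay g (fst (us n)) (snd (us n))) 1) as [y Hy].
  { intros n. destruct (Hus n) as [H1 [H2 _]]. pose proof (fpay_bounds _ _ H1 H2).
    apply Rabs_le. lra. }
  assert (Hy01 : 0 <= y <= 1).
  { split; [eapply ulim_le|eapply ulim_ge]; eauto; intros n; destruct (Hus n) as [H1 [H2 _]];
      apply (fpay_bounds _ _ H1 H2). }
  assert (HRR : RR K X q g m y).
  { split; [auto|]. split; [auto|]. intros hs d Hhs Hd.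
    assert (Hh : Forall (fun h => U (fun n => Rabs (fexp (fst (us n)) h - m h) < d /\
      Rabs (fexp (fnext q (fst (us n)) (snd (us n))) h - m h) < d)) hs).
    { eapply Forall_impl; [|exact Hhs]. intros h Hh. simpl.
      destruct (cont_bounded K X h HXc Hh) as [B [HB0 HB]].
      (* The invariance error is [4 * al n * B], to be kept below [d / 2]; the [+ 1] covers
         [B = 0]. *)
      destruct (Hal0 (d / 2 / (4 * B + 1))) as [N HN]; [apply Rdiv_lt_0_compat; lra|].
      eapply Us; [|apply (Ui _ _ (Hm h Hh (d / 2) ltac:(lra)) (Uc (fun n => (N <= n)%nat) N ltac:(auto)))].
      intros n [H1 H2]. simpl in H1. specialize (HN n H2).
      destruct (Hus n) as [_ [_ [_ [H3 _]]]]. specialize (H3 h B HB).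
      assert (H4 : (3 * al n + al n) * B <= d / 2).
      { apply (Rmult_lt_compat_r (4 * B + 1)) in HN; [|lra].
        replace (d / 2 / (4 * B + 1) * (4 * B + 1)) with (d / 2) in HN by (field; lra).
        specialize (Hal n). lra. }
      pose proof (Rabs_bound _ _ (Rle_trans _ _ _ H3 H4)). apply Rabs_def2 in H1.
      split; apply Rabs_def1; lra. }
    pose proof (ultra_Forall U HU (fun h n => Rabs (fexp (fst (us n)) h - m h) < d /\
      Rabs (fexp (fnext q (fst (us n)) (snd (us n))) h - m h) < d) hs Hh) as Hh'.
    destruct (ultra_ex U HU _ (Ui _ _ Hh' (Hy d Hd))) as [n [Hn1 Hn2]].
    destruct (Hus n) as [H1 [H2 _]].
    exists (fst (us n)), y, (snd (us n)). repeat split; try apply H1; try apply Hy01; auto.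
    - apply H2; auto.
    - apply H2; auto.
    - eapply Forall_impl; [|exact Hn1]. intros h []. auto.
    - rewrite Rminus_diag, Rabs_R0. auto.
    - eapply Forall_impl; [|exact Hn1]. intros h []. auto. }
  pose proof (HwRR m y HRR) as Hwy.
  (* The contradiction: [y] is at least [f x + e] up to two errors [e / 4], and [y <= w m]; but
     [w m] is within [e / 4] of the integral of [f] under some [us n], which is at most [f x]. *)
  destruct (Hcont m Hprob (e / 4)) as [hs [d [Hhs [Hd Hnear]]]]; [lra|].
  destruct (Hal0 (e / 4)) as [N HN]; [lra|].
  assert (Hh : Forall (fun h => U (fun n => Rabs (fexp (fst (us n)) h - m h) < d)) hs).
  { eapply Forall_impl; [|exact Hhs]. intros h Hh. now apply Hm. }
  pose proof (ultra_Forall U HU (fun h n => Rabs (fexp (fst (us n)) h - m h) < d) hs Hh) as Hh'.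
  destruct (ultra_ex U HU _ (Ui _ _ (Ui _ _ Hh' (Hy (e / 4) ltac:(lra)))
    (Uc (fun n => (N <= n)%nat) N ltac:(auto)))) as [n [[Hn1 Hn2] Hn3]].
  destruct (Hus n) as [H1 [H2 [H3 [_ H5]]]]. specialize (HN n Hn3).
  specialize (Hnear (emb (fst (us n))) (prob_emb K X _ H1) Hn1).
  rewrite affine_emb in Hnear by auto. fold f in Hnear.
  apply Rabs_def2 in Hnear, Hn2. lra.
Qed.

(** * The general uniform value *)

(** Arbitrarily patient evaluations exist, so bounds on [V theta] yield information on [vs]. The
    weights decrease by the ratio [1 - l], and their variation is at most [l]; [l <= 1/2] keeps the
    ratio positive. *)
Lemma geometric_evaluation al : 0 < al -> exists theta,
  subeval theta /\ full_mass theta /\ impatience_le theta al.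
Proof.
  intros Hal. set (l := Rmin al (1 / 2)).
  assert (Hl : 0 < l <= 1 / 2) by (split; [apply Rmin_glb_lt; lra|apply Rmin_r]).
  set (theta := fun n => l * (1 - l) ^ n).
  assert (Hpow : forall n, 0 < (1 - l) ^ n) by (intros n; apply pow_lt; lra).
  assert (Hsum : forall n, sumK n theta = 1 - (1 - l) ^ n).
  { induction n as [|n IH]; simpl; [ring|]. rewrite IH. unfold theta. ring. }
  assert (Hsub : subeval theta).
  { split.
    - intros n. unfold theta. specialize (Hpow n). apply Rmult_le_pos; lra.
    - intros n. rewrite Hsum. specialize (Hpow n). lra. }
  exists theta. split; [auto|]. split.
  - intros e He. destruct (pow_lt_1_zero (1 - l)) with (y := e) as [N HN]; auto.
    + rewrite Rabs_pos_eq; lra.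
    + exists N. rewrite Hsum. specialize (HN N ltac:(lia)). apply Rabs_def2 in HN. lra.
  - intros n. rewrite (sumK_ext n _ (fun t => l * theta t + 0 * theta t)).
    + rewrite sumK_lin. pose proof (proj2 Hsub n). pose proof (Rmin_l al (1 / 2)). fold l in H0.
      assert (l * sumK n theta <= l * 1) by (apply Rmult_le_compat_l; lra). lra.
    + intros t _. unfold theta. simpl.
      replace (l * ((1 - l) * (1 - l) ^ t) - l * (1 - l) ^ t) with (- (l * (l * (1 - l) ^ t))) by ring.
      specialize (Hpow t). rewrite Rabs_Ropp, Rabs_pos_eq; [ring|].
      apply Rmult_le_pos; [lra|]. apply Rmult_le_pos; lra.
Qed.

Lemma impatience_le_weaken theta a b : impatience_le theta a -> a <= b -> impatience_le theta b.
Proof. intros H Hab n. specialize (H n). lra. Qed.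

Lemma value_upper_bound_vs x e : X x -> 0 < e ->
  exists al, 0 < al /\ forall theta, subeval theta -> full_mass theta -> impatience_le theta al ->
    V theta x <= vs x + e.
Proof.
  intros Hx He.
  assert (Hw : exists w, admissible K X q g w /\ w (dirac x) < vs x + e / 2).
  { apply NNPP. intros Hno. destruct (Hvs x Hx) as [_ Hglb].
    assert (vs x + e / 2 <= vs x); [|lra]. apply Hglb. intros r [w [Hw ->]].
    apply Rnot_lt_le. intros Hlt. apply Hno. now exists w. }
  destruct Hw as [w [Hw Hwx]].
  destruct (value_upper_bound_at w x (e / 2) Hw Hx) as [al [Hal H]]; [lra|].
  exists al. split; [auto|]. intros theta H1 H2 H3. specialize (H theta H1 H2 H3). lra.
Qed.

(** Regularity is not visible on an infimum over all admissible [w]. It is read off one patient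
    [theta]: [vs x] is at most [V theta x] and [V theta y] at most [vs y], up to small errors, and
    [V theta] is 1-Lipschitz. *)
Lemma vs_lipschitz x y : X x -> X y -> vs x <= vs y + norm1 K (fun k => x k - y k).
Proof.
  intros Hx Hy. apply Rnot_lt_le. intros Hlt.
  set (e := (vs x - vs y - norm1 K (fun k => x k - y k)) / 3).
  assert (He : 0 < e) by (unfold e; lra).
  destruct (value_lower_bound e He) as [a1 [Ha1 H1]].
  destruct (value_upper_bound_vs y e Hy He) as [a2 [Ha2 H2]].
  destruct (geometric_evaluation (Rmin a1 a2)) as [theta [Hs [Hf Hi]]]; [now apply Rmin_glb_lt|].
  specialize (H1 theta Hs Hf (impatience_le_weaken _ _ _ Hi (Rmin_l _ _)) x Hx).
  specialize (H2 theta Hs Hf (impatience_le_weaken _ _ _ Hi (Rmin_r _ _))).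
  pose proof (hlip_lip K X _ x y (V_hlip theta Hs) Hx Hy). unfold e in *. lra.
Qed.

(** The pointwise thresholds are made common on a finite net of [X]; one third of [e] is spent
    there, and one on each of the Lipschitz displacements of [V theta] and [vs]. *)
Lemma value_upper_bound e : 0 < e -> exists al, 0 < al /\
  forall theta, subeval theta -> full_mass theta -> impatience_le theta al ->
  forall x, X x -> V theta x <= vs x + e.
Proof.
  intros He. destruct (simplex_net K X (e / 3) HX) as [L [HL Hn]]; [lra|].
  destruct (common_threshold (fun al z => forall theta, subeval theta -> full_mass theta ->
    impatience_le theta al -> V theta z <= vs z + e / 3) L) as [al [Hal H]].
  - intros a b z Hab H theta H1 H2 H3. apply H; auto. apply impatience_le_weaken with b; auto. lra.
  - eapply Forall_impl; [|exact HL]. intros z Hz. apply value_upper_bound_vs; auto. lra.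
  - exists al. split; [auto|]. intros theta H1 H2 H3 x Hx.
    destruct (Hn x Hx) as [z [Hz [Hxz Hzx]]]. rewrite Forall_forall in HL, H.
    specialize (H z Hz theta H1 H2 H3).
    pose proof (hlip_lip K X _ x z (V_hlip theta H1) Hx (HL z Hz)).
    pose proof (vs_lipschitz z x (HL z Hz) Hx). lra.
Qed.

Lemma patient_family_convex al :
  convex_family (fun theta => subeval theta /\ full_mass theta /\ impatience_le theta al).
Proof.
  split; [tauto|]. intros theta theta' l [[H0 H1] [Hf Hi]] [[H0' H1'] [Hf' Hi']] Hl.
  split; [split|split].
  - intros n. specialize (H0 n). specialize (H0' n). nra.
  - intros n. rewrite sumK_lin. specialize (H1 n). specialize (H1' n). nra.
  - intros e He. destruct (Hf e He) as [n Hn]. destruct (Hf' e He) as [n' Hn'].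
    exists (max n n'). rewrite sumK_lin.
    pose proof (sumK_mono theta n (max n n') H0 ltac:(lia)).
    pose proof (sumK_mono theta' n' (max n n') H0' ltac:(lia)). nra.
  - intros n. apply Rle_trans with (sumK n (fun t => l * Rabs (theta (S t) - theta t) +
      (1 - l) * Rabs (theta' (S t) - theta' t))).
    + apply sumK_le. intros t _.
      replace (l * theta (S t) + (1 - l) * theta' (S t) - (l * theta t + (1 - l) * theta' t)) with
        (l * (theta (S t) - theta t) + (1 - l) * (theta' (S t) - theta' t)) by ring.
      eapply Rle_trans; [apply Rabs_triang|]. rewrite !Rabs_mult.
      rewrite (Rabs_pos_eq l), (Rabs_pos_eq (1 - l)) by lra. lra.
    + rewrite sumK_lin. specialize (Hi n). specialize (Hi' n). nra.
Qed.

Lemma partial_sum_le f l n : (forall n, 0 <= f n) -> infinite_sum f l -> sumK n f <= l.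
Proof.
  intros Hf Hl. apply Rle_trans with (sumK (S n) f); [apply sumK_mono; auto|].
  rewrite <- sum_f_R0_sumK. now apply sum_incr.
Qed.

Lemma eval_subeval theta : is_eval theta -> subeval theta /\ full_mass theta.
Proof.
  intros [H0 H1]. split; [split; [auto|]|].
  - intros n. now apply partial_sum_le.
  - intros e He. destruct (H1 e He) as [N HN]. exists (S N).
    specialize (HN N ltac:(lia)). unfold Rdist in HN. rewrite sum_f_R0_sumK in HN.
    apply Rabs_def2 in HN. lra.
Qed.

Lemma impatience_is_le theta I al : impatience_is theta I -> I <= al -> impatience_le theta al.
Proof.
  intros H HI n. eapply Rle_trans; [|exact HI].
  apply (partial_sum_le (fun t => Rabs (theta (S t) - theta t))); auto. intros; apply Rabs_pos.
Qed.

Lemma gamma_exists theta sg x : X x -> valid_strategy sg -> is_eval theta ->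
  exists r, gamma_is q g theta x sg r.
Proof.
  intros Hx Hsg Heval. destruct (eval_subeval theta Heval) as [[H0 H1] _].
  assert (Hpos : forall n, 0 <= theta n * stage_payoff q g sg x n <= theta n).
  { intros n. pose proof (stage_payoff_bounds sg x n Hx Hsg). specialize (H0 n). nra. }
  destruct (growing_cv (fun n => sum_f_R0 (fun n => theta n * stage_payoff q g sg x n) n)) as [r Hr].
  - intros n. simpl. specialize (Hpos (S n)). lra.
  - exists 1. intros z [n ->]. rewrite sum_f_R0_sumK.
    eapply Rle_trans; [|apply (H1 (S n))]. apply sumK_le. intros k _. apply Hpos.
  - exists r. exact Hr.
Qed.

Lemma gamma_le_V theta sg x r : X x -> valid_strategy sg -> is_eval theta ->
  gamma_is q g theta x sg r -> r <= V theta x.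
Proof.
  intros Hx Hsg Heval Hr. destruct (eval_subeval theta Heval) as [Hsub _].
  apply Rnot_lt_le. intros Hlt. destruct (Hr (r - V theta x)) as [N HN]; [lra|].
  specialize (HN N ltac:(lia)). unfold Rdist in HN. rewrite sum_f_R0_sumK in HN.
  apply Rabs_def2 in HN.
  pose proof (strategy_le_V sg theta x Hx Hsg Hsub (S N)) as H.
  assert (0 <= fexp (stage_dist q sg x (S N)) (fun hx => V (shn (S N) theta) (snd hx))); [|lra].
  apply fexp_ge_const with (reach (S N)); [now apply stage_dist_fdist|].
  intros hx [Hhx _]. apply V_bnd1; auto using subeval_shn.
Qed.

(** The selections guarantee [vs x - e] for past plus continuation at every stage and for every
    patient [theta]. The stage at which the continuation becomes negligible may depend on [theta],
    because the selections do not. *)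
Lemma patient_strategies e : 0 < e -> exists al, 0 < al /\
  exists sgs : pt -> strategy A, (forall x, X x -> valid_strategy (sgs x)) /\
    forall theta, is_eval theta -> impatience_le theta al ->
      forall x r, X x -> gamma_is q g theta x (sgs x) r -> vs x - e <= r.
Proof.
  intros He. destruct (value_lower_bound (e / 2)) as [al [Hal Hlow]]; [lra|].
  exists al. split; [auto|].
  set (Th := fun theta => subeval theta /\ full_mass theta /\ impatience_le theta al).
  destruct (choice (fun x s => X x -> (forall t, selection (s t)) /\ forall t theta, Th theta ->
    vs x - e / 2 - e / 2 <= sumK t (fun k => theta k * fpay g (law x s k) (s k))
      + fexp (law x s t) (V (shn t theta)))) as [s Hs].
  { intros x. destruct (classic (X x)) as [Hx|Hx].
    - destruct (simultaneous_selections Th x (vs x - e / 2) (e / 2)) as [s Hs]; auto.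
      + apply patient_family_convex.
      + intros theta [H1 [H2 H3]]. now apply Hlow.
      + lra.
      + now exists s.
    - exists (fun _ _ => []). tauto. }
  destruct HA as [a0]. exists (fun x => markov a0 (s x)). split.
  - intros x Hx. apply markov_valid. now apply Hs.
  - intros theta Heval Himp x r Hx Hr. destruct (Hs x Hx) as [Hsel Hgood].
    destruct (eval_subeval theta Heval) as [Hsub Hfull].
    apply Rnot_lt_le. intros Hlt.
    (* Beyond stage [n] the remaining mass, hence the continuation value, is at most half of the
       supposed gap, so the first [n] stages alone would pay more than [r]. *)
    destruct (Hfull ((vs x - e - r) / 2)) as [n Hn]; [lra|].
    specialize (Hgood n theta (conj Hsub (conj Hfull Himp))).
    pose proof (fexp_le_const X _ _ _ (fdist_law x (s x) n Hx Hsel)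
      (fun z Hz => proj2 (V_shn_small theta n _ Hsub Hn z Hz))) as Htail.
    assert (Hpart : sumK n (fun k => theta k * fpay g (law x (s x) k) (s x k)) <= r); [|lra].
    apply Rle_trans with (sumK n (fun k => theta k * stage_payoff q g (markov a0 (s x)) x k)).
    + right. apply sumK_ext. intros k _. now rewrite stage_payoff_markov.
    + apply partial_sum_le; [|exact Hr]. intros k. apply Rmult_le_pos; [apply Hsub|].
      apply stage_payoff_bounds; auto using markov_valid.
Qed.

End MDP.

Theorem theorem4 (K : nat) (X : pt -> Prop) (A : Type)
  (q : pt -> A -> list (pt * R)) (g : pt -> A -> R)
  (HX : forall x, X x -> simplex K x) (HXc : seq_compact K X) (HA : inhabited A)
  (Hq : forall x a, X x -> is_fdist X (q x a))
  (Hg : forall x a, X x -> 0 <= g x a <= 1)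
  (Hqf : forall x y a f al be, X x -> X y -> D1 K f -> 0 <= al -> 0 <= be ->
     Rabs (al * fexp (q x a) f - be * fexp (q y a) f) <= norm1 K (lin al x be y))
  (Hgl : forall x y a al be, X x -> X y -> 0 <= al -> 0 <= be ->
     Rabs (al * g x a - be * g y a) <= norm1 K (lin al x be y))
  (vs : pt -> R) (Hvs : forall x, X x -> is_glb (vstar_set K X q g x) (vs x)) :
  general_uniform_value X q g vs.
Proof.
  split.
  - intros e He.
    destruct (patient_strategies K X A q g HX HA Hq Hg Hqf Hgl vs Hvs e He)
      as [a1 [Ha1 [sgs [Hval Hgood]]]].
    destruct (value_upper_bound K X A q g HX HXc HA Hq Hg Hqf Hgl vs Hvs e He) as [a2 [Ha2 Hup]].
    exists (Rmin a1 a2). split; [now apply Rmin_glb_lt|].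
    intros theta I Heval Himp HI x v Hx [Hub Hlub].
    destruct (eval_subeval theta Heval) as [Hsub Hfull].
    pose proof (Rmin_l a1 a2). pose proof (Rmin_r a1 a2).
    assert (Hvle : v <= vs x + e).
    { apply Hlub. intros r [sg [Hsg Hr]].
      eapply Rle_trans; [eapply gamma_le_V; eauto|].
      apply Hup; auto. apply impatience_is_le with I; auto. lra. }
    (* Convergence of its payoff series makes the uniform strategy a competitor in the supremum [v],
       so the lower half of the limit value follows from the uniform guarantee. *)
    destruct (gamma_exists X A q g Hq Hg theta (sgs x) x Hx (Hval x Hx) Heval) as [r Hr].
    assert (vs x - e <= r).
    { apply (Hgood theta Heval); auto. apply impatience_is_le with I; auto. lra. }
    assert (r <= v) by (apply Hub; exists (sgs x); auto).
    apply Rabs_le. lra.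
  - intros e He.
    destruct (patient_strategies K X A q g HX HA Hq Hg Hqf Hgl vs Hvs e He)
      as [al [Hal [sgs [Hval Hgood]]]].
    exists al. split; [auto|]. exists sgs. split; [auto|].
    intros theta I Heval Himp HI x r Hx Hr. apply Rle_ge.
    apply (Hgood theta Heval); auto. now apply impatience_is_le with I.
Qed.
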